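(* Let $q\ge 2$ be an integer, let $T_1,\dots,T_q:[0,1]\to[0,1]$ be maps and let $\bar T:[0,1]^q\to[0,1]^q$, $\bar T(x_1,\dots,x_q)=(T_1(x_1),\dots,T_q(x_q))$, be the product map, assumed piecewise smooth. Let $P$ be the transfer operator of $\bar T$ with respect to Lebesgue measure $\mathrm{Leb}$ on $[0,1]^q$, and let $0<\alpha\le 1$. Assume: (LY) $P$ maps $V_\alpha$ into itself and there exist $\eta\in(0,1)$ and $D>0$ such that $\|Pf\|_\alpha\le \eta\|f\|_\alpha+D\|f\|_{L^1}$ for all $f\in V_\alpha$; (B1) on $V_\alpha$ the operator $P$ has the form $P=h\otimes \mathrm{Leb}+Q$, i.e. $Pf=\big(\int f\,d\mathrm{Leb}\big)h+Qf$, where $h\in V_\alpha$, $\int h\,d\mathrm{Leb}=1$, $\int Qf\,d\mathrm{Leb}=0$ for all $f\in V_\alpha$, $Qh=0$, and the spectral radius of $Q$ on $V_\alpha$ is strictly less than $1$; (positivity) there exists $c>0$ with $h\ge c$. Let $\mu:=h\,\mathrm{Leb}$. Let $s>0$ and assume there is a sequence $(u_n)_n$ of real numbers such that, with $\Delta_n:=\{\varphi>u_n\}$, $$\lim_{n\to\infty} n\,\mu(\Delta_n)=s,$$ and that for each integer $k\ge 0$ the limit $$p_k:=\lim_{n\to\infty}\frac{\mu\left(\Delta_n\cap\bar T^{-1}\Delta_n^c\cap\cdots\cap\bar T^{-k}\Delta_n^c\cap\bar T^{-(k+1)}\Delta_n\right)}{\mu(\Delta_n)}$$ exists. Then $$\lim_{n\to\infty}\mu(M_n\le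 u_n)=e^{-\theta s},\qquad \theta:=1-\sum_{k=0}^\infty p_k.$$
   Context: The observable is $\varphi:[0,1]^q\to\mathbb{R}\cup\{\infty\}$, $\varphi(x_1,\dots,x_q)=-\log\max_{2\le j\le q}|x_1-x_j|$. The process is $Y_i:=\varphi\circ\bar T^i$, $i\ge0$, and $M_n:=\max\{Y_0,\dots,Y_{n-1}\}$. The transfer operator $P:L^1([0,1]^q,\mathrm{Leb})\to L^1([0,1]^q,\mathrm{Leb})$ of a nonsingular map $\bar T$ is defined by $\int (Pf)\,g\,d\mathrm{Leb}=\int f\,(g\circ\bar T)\,d\mathrm{Leb}$ for $f\in L^1$, $g\in L^\infty$. Quasi-Hölder space: fix $\epsilon_0>0$. For a measurable $f$ and a set $B$, $\operatorname{osc}(f,B)$ is the essential supremum minus the essential infimum of $f$ on $B\cap[0,1]^q$. Set $|f|_\alpha=\sup_{0<\epsilon\le\epsilon_0}\epsilon^{-\alpha}\int_{[0,1]^q}\operatorname{osc}(f,B_\epsilon(x))\,dx$, $V_\alpha=\{f\in L^1([0,1]^q,\mathrm{Leb}):|f|_\alpha<\infty\}$, and $\|f\|_\alpha=\|f\|_{L^1}+|f|_\alpha$. (Different $\epsilon_0$ give the same space and equivalent norms.) *)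

(* Defs.v *)
From HB Require Import structures.
From mathcomp Require Import all_boot all_order all_algebra.
From mathcomp Require Import all_classical all_reals all_analysis.
From mathcomp Require Import ess_sup_inf.

Set Implicit Arguments.
Unset Strict Implicit.
Unset Printing Implicit Defensive.
Import Order.TTheory GRing.Theory Num.Theory.
Import numFieldNormedType.Exports.

Local Open Scope classical_set_scope.
Local Open Scope ring_scope.

(* The q-tuples of reals carry the product sigma-algebra of q copies of the
   Borel sigma-algebra of R. *)
Notation Rq R q := (q.-tuple (measurableTypeR R)).

Section lebesgue_tuple.
Context {R : realType}.

Definition tcons n (p : measurableTypeR R * Rq R n) : Rq R n.+1 :=
  [tuple of p.1 :: p.2].
Definition tuncons n (x : Rq R n.+1) : measurableTypeR R * Rq R n :=
  (thead x, [tuple of behead x]).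

Lemma tconsK n : cancel (@tcons n) (@tuncons n).
Proof. by move=> [a t]; congr pair; apply/val_inj. Qed.

Lemma tunconsK n : cancel (@tuncons n) (@tcons n).
Proof. by move=> x; rewrite [RHS]tuple_eta. Qed.

Lemma measurable_tcons n : measurable_fun [set: _] (@tcons n).
Proof. exact: measurable_cons. Qed.

Lemma measurable_tuncons n : measurable_fun [set: _] (@tuncons n).
Proof.
apply/measurable_fun_pairP; split; last exact: measurable_behead.
exact: measurable_tnth.
Qed.

Section step.
Context n (m : {sigma_finite_measure set (Rq R n) -> \bar R}).

Definition leb_step : set (Rq R n.+1) -> \bar R :=
  pushforward (lebesgue_measure \x m)%E (@tcons n).

Let leb_step0 : leb_step set0 = 0%E.
Proof. by rewrite /leb_step /pushforward preimage_set0 measure0. Qed.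

Let leb_step_ge0 A : (0 <= leb_step A)%E.
Proof. by rewrite /leb_step /pushforward; apply: measure_ge0. Qed.

Let leb_step_sigma_additive : semi_sigma_additive leb_step.
Proof.
move=> F mF tF mUF; rewrite /leb_step /pushforward preimage_bigcup.
apply: measure_semi_sigma_additive.
- by move=> i; rewrite -[X in measurable X]setTI; exact: measurable_tcons.
- apply/trivIsetP => /= i j _ _ ij; rewrite -preimage_setI.
  by move/trivIsetP : tF => /(_ _ _ _ _ ij) ->//; rewrite preimage_set0.
- by rewrite -preimage_bigcup -[X in measurable X]setTI; exact: measurable_tcons.
Qed.

HB.instance Definition _ := isMeasure.Build _ _ _ leb_step
  leb_step0 leb_step_ge0 leb_step_sigma_additive.

Let leb_step_sigma_finite : sigma_finite setT leb_step.
Proof.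
have /sigma_finiteP[F [TF ndF Foo]] := sigma_finiteT (@lebesgue_measure R).
have /sigma_finiteP[G [TG ndG Goo]] := sigma_finiteT m.
exists (fun i => @tuncons n @^-1` (F i `*` G i)).
  apply/esym/seteqP; split => // x _.
  have [[i _ Fi] [j _ Gj]] : (\bigcup_i F i) (thead x) /\
      (\bigcup_i G i) [tuple of behead x] by rewrite -TF -TG.
  exists (maxn i j) => //; split => /=.
    by move: Fi; exact/subsetPset/ndF/leq_maxl.
  by move: Gj; exact/subsetPset/ndG/leq_maxr.
move=> i; have [mF Fi] := Foo i; have [mG Gi] := Goo i; split.
  rewrite -[X in measurable X]setTI; apply: measurable_tuncons => //.
  exact: measurableX.
rewrite /leb_step /pushforward.
rewrite (_ : _ @^-1` _ = F i `*` G i).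
  by rewrite product_measure1E// lte_mul_pinfty// ge0_fin_numE.
by apply/seteqP; split => p; rewrite /preimage /mkset tconsK.
Qed.

HB.instance Definition _ :=
  @Measure_isSigmaFinite.Build _ _ _ leb_step leb_step_sigma_finite.
End step.

(* Lebesgue measure on R^n, as the n-fold product of Lebesgue measure on R;
   R^0 is a point of mass 1. *)
Fixpoint lebn n : {sigma_finite_measure set (Rq R n) -> \bar R} :=
  match n with
  | 0 => @dirac _ (Rq R 0) [tuple] R
  | m.+1 => leb_step (lebn m)
  end.

End lebesgue_tuple.

Notation Leb := (lebn _).

Section dynamics.
Context {R : realType}.
Implicit Types (q n k : nat).

Definition cube q : set (Rq R q) := [set x | forall i, tnth x i \in `[0, 1]].

Definition prodmap q (T : 'I_q -> R -> R) (x : Rq R q) : Rq R q :=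
  [tuple T i (tnth x i) | i < q].

(* The Euclidean ball of R^q. *)
Definition eball q (x : Rq R q) (e : R) : set (Rq R q) :=
  [set y | Num.sqrt (\sum_(i < q) (tnth y i - tnth x i) ^+ 2) < e].

Definition rV_of_tuple q (x : Rq R q) : 'rV[R]_q := \row_i tnth x i.
Definition tuple_of_rV q (v : 'rV[R]_q) : Rq R q := [tuple v ord0 i | i < q].

(* Up to a Lebesgue-null set the cube is a countable disjoint union of open
   sets (some possibly empty) on each of which F is continuously
   differentiable.  C^1 is the least regularity called smooth, and nothing is
   required at the boundaries of the pieces. *)
Definition piecewise_smooth q (F : Rq R q -> Rq R q) :=
  let G := @rV_of_tuple q \o F \o @tuple_of_rV q in
  exists U : nat -> set 'rV[R]_q,
  [/\ forall k, open (U k),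
      trivIset setT U,
      forall k v, U k v -> cube (tuple_of_rV v),
      {ae Leb, forall x, cube x -> exists k, U k (rV_of_tuple x)} &
      forall k v, U k v ->
        differentiable G v /\ {for v, continuous (jacobian G)} ].

Definition nonsingular q (F : Rq R q -> Rq R q) :=
  measurable_fun (@cube q) F /\
  forall A, measurable A -> Leb A = 0%E -> Leb (@cube q `&` F @^-1` A) = 0%E.

(* Elements of L^1, L^oo and V_alpha are represented by functions whose values
   outside the cube are irrelevant; equalities between them hold a.e. *)
Definition ae_eq_cube q (f g : Rq R q -> R) :=
  {ae Leb, forall x, cube x -> f x = g x}.

Definition integral_cube q (f : Rq R q -> R) : R :=
  \int[Leb]_(x in @cube q) f x.

Definition inL1 q (f : Rq R q -> R) := Leb.-integrable (@cube q) (EFin \o f).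

Definition normL1 q (f : Rq R q -> R) : \bar R :=
  (\int[Leb]_(x in @cube q) `|(f x)%:E|)%E.

Definition inLoo q (g : Rq R q -> R) :=
  measurable_fun (@cube q) g /\
  exists M : R, {ae Leb, forall x, cube x -> `|g x| <= M}.

Definition transfer_operator q (F : Rq R q -> Rq R q)
    (P : (Rq R q -> R) -> Rq R q -> R) :=
  forall f, inL1 f -> inL1 (P f) /\
    forall g, inLoo g ->
      integral_cube (P f \* g) = integral_cube (f \* (g \o F)).

(* The values -oo and +oo discard the points outside of B and the cube. *)
Definition osc q (f : Rq R q -> R) (B : set (Rq R q)) : \bar R :=
  (ess_sup Leb (fun x => if x \in B `&` @cube q then (f x)%:E else -oo)
   - ess_inf Leb (fun x => if x \in B `&` @cube q then (f x)%:E else +oo))%E.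

Section quasi_holder.
Variables (q : nat) (eps0 alpha : R).

Definition seminorm_alpha (f : Rq R q -> R) : \bar R :=
  ereal_sup [set ((e `^ (- alpha))%:E *
                  \int[Leb]_(x in @cube q) osc f (eball x e))%E
            | e in [set e : R | 0 < e <= eps0]].

Definition inV (f : Rq R q -> R) := inL1 f /\ (seminorm_alpha f < +oo)%E.

Definition norm_alpha (f : Rq R q -> R) : \bar R :=
  (normL1 f + seminorm_alpha f)%E.

Definition opnorm (Q : (Rq R q -> R) -> Rq R q -> R) : \bar R :=
  ereal_sup [set norm_alpha (Q f) | f in [set f | inV f /\ (norm_alpha f <= 1)%E]].

(* V_alpha is a real normed space; the spectral radius of an operator on it is
   lim_n |Q^n|^(1/n).  The limit exists for a bounded operator; taken as a
   limsup it is +oo when the Q^n are unbounded. *)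
Definition spectral_radius (Q : (Rq R q -> R) -> Rq R q -> R) : \bar R :=
  limn_esup (fun n => poweR (opnorm (iter n Q)) n%:R^-1).

End quasi_holder.

(* Indices start at 0: x`_0 is the first coordinate; lne 0 = -oo. *)
Definition phi q (x : Rq R q) : \bar R :=
  (- lne (\big[Num.max/0%R]_(1 <= j < q) `|x`_0 - x`_j|%R)%:E)%E.

Definition Yproc q (F : Rq R q -> Rq R q) (i : nat) (x : Rq R q) : \bar R :=
  phi (iter i F x).

Definition Mproc q (F : Rq R q -> Rq R q) (n : nat) (x : Rq R q) : \bar R :=
  \big[maxe/-oo%E]_(i < n) Yproc F i x.

Definition Delta q (r : R) : set (Rq R q) :=
  @cube q `&` [set x | (r%:E < phi x)%E].

(* Points of Delta whose orbit avoids Delta at times 1..k and is back at k+1. *)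
Definition first_return q (F : Rq R q -> Rq R q) (r : R) (k : nat) :
    set (Rq R q) :=
  Delta r `&` \bigcap_(j in [set j | (1 <= j <= k)%N])
                (@cube q `&` iter j F @^-1` (~` Delta r))
          `&` iter k.+1 F @^-1` (Delta r).

(* The measure h Leb, on subsets of the cube. *)
Definition density_measure q (h : Rq R q -> R) (A : set (Rq R q)) : R :=
  \int[Leb]_(x in A) h x.

End dynamics.

(* Main.v *)
Require Import Defs.
From HB Require Import structures.
From mathcomp Require Import all_boot all_order all_algebra.
From mathcomp Require Import all_classical all_reals all_analysis.
From mathcomp Require Import measurable_realfun ess_sup_inf.
From mathcomp Require Import ring lra.
From mathcomp Require Import zify.
Import Order.TTheory GRing.Theory Num.Theory.
Import numFieldNormedType.Exports.
Local Open Scope classical_set_scope.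
Local Open Scope ring_scope.

Set Implicit Arguments.
Unset Strict Implicit.
Unset Printing Implicit Defensive.

(* Write [mu] for the measure h Leb, [D] for the target set Delta_n, and let
   w_m be the mu-measure of the points whose orbit avoids [D] at times 0..m-1,
   a_m that of the points of [D] which do not return to [D] at times 1..m.
   Invariance of [mu] gives w_(m+1) = w_m - a_m.  On V_alpha one has
   P^n f = (int f) h + Q^n f with |Q^n f|_oo = O(rho^n |f|_alpha), because
   V_alpha embeds into L^oo; and multiplication by the indicator of [D] or of
   its complement is bounded on V_alpha uniformly in n, the boundary of [D]
   having e-neighbourhoods of measure O(e).  Hence, opening a gap of length t
   after time k,
     |a_m - a_k w_m| <= mu(D) (C (k + t) mu(D) + C rho^k) + C_k rho^t,
   so w_n is close to (1 - a_k)^n.  Since n mu(D) -> s and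
   a_k / mu(D) -> 1 - sum_(j < k) p_j, letting n and then k go to infinity gives
   the result. *)

(** * A perturbed geometric recursion *)

Section real_analysis.
Context {R : realType}.

(** Origin of the error terms. Opening the gap changes a_m by at most the sum, over the times j of
    the gap, of mu(D and F^-j D). Decay of correlations bounds each term by mu(D) (mu(D) +
    O(rho^j)): the mixing error is proportional to the Lebesgue integral of the test function, and h
    >= c turns Leb(D) into mu(D) / c, which supplies the outer factor mu(D). All these j exceed k,
    so the geometric parts add up to O(rho^k). Across the gap, decay is applied to a density
    obtained by alternating P with multiplications by indicators; its norm grows geometrically in k
    but is uniform in n. This is C_k, and it is why n tends to infinity before k. P and Q act on
    representatives and are determined only up to null sets. Their iterates are therefore read
    through integrals against [0,1]-valued test functions, by duality, and events enter as products
    of indicators along the orbit. *)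

Lemma sum_powers_le (r : R) (m : nat) : 0 <= r < 1 ->
  \sum_(i < m) r ^+ i <= (1 - r)^-1.
Proof.
move=> /andP[r0 r1].
rewrite -[leRHS]mul1r ler_pdivlMr ?subr_gt0// mulrC.
by rewrite -opprB mulNr -subrX1 opprB lerBlDr lerDl exprn_ge0.
Qed.

Lemma natM_exp_le (r : R) (m : nat) : 0 <= r < 1 ->
  m%:R * r ^+ m <= (1 - r)^-1.
Proof.
move=> /[dup] r01 /andP[r0 r1]; apply: le_trans (sum_powers_le m r01).
have -> : m%:R * r ^+ m = \sum_(i < m) r ^+ m by rewrite sumr_const card_ord mulr_natl.
apply: ler_sum => i _; apply: ler_wiXn2l => //; first exact: ltW.
exact/ltnW/ltn_ord.
Qed.

(** With [r = q ^+ 2] and [t = n %/ k.+1], the power [r ^+ t] is [q ^+ t * q ^+ t]: one factor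
    absorbs [n <= k.+1 * t.+1], the other still tends to 0. *)
Lemma cvg_natM_exp_divn (r : R) (k : nat) : 0 <= r < 1 ->
  n%:R * r ^+ (n %/ k.+1) @[n --> \oo] --> (0 : R).
Proof.
move=> /andP[r0 r1].
pose q := Num.sqrt r.
have qq : q ^+ 2 = r by rewrite sqr_sqrtr.
have q0 : 0 <= q by exact: sqrtr_ge0.
have q1 : q < 1 by rewrite -sqrtr1 ltr_sqrt.
have qq0 : 0 < 1 - q by rewrite subr_gt0.
apply: (@squeeze_cvgr _ _ _ _ (fun=> 0)
  (fun n => k.+1%:R * ((1 - q)^-1 + 1) * q ^+ (n %/ k.+1))).
- near=> n; rewrite mulr_ge0 ?exprn_ge0//=.
  set t := (n %/ k.+1)%N.
  have nt : (n <= k.+1 * t.+1)%N by rewrite mulnC ltnW// ltn_ceil.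
  rewrite -qq -exprM mulnC exprM expr2 mulrA ler_wpM2r ?exprn_ge0//.
  apply: (@le_trans _ _ ((k.+1 * t.+1)%:R * q ^+ t)).
    by rewrite ler_wpM2r ?exprn_ge0// ler_nat.
  rewrite natrM -mulrA ler_wpM2l// -natr1 mulrDl mul1r lerD//.
    by apply: natM_exp_le; rewrite q0.
  by rewrite exprn_ile1// ltW.
- exact: cvg_cst.
- rewrite -[X in _ --> X](mulr0 (k.+1%:R * ((1 - q)^-1 + 1))).
  apply: cvgMr; apply: (@cvg_comp _ _ _ (fun n => n %/ k.+1)%N (fun t => q ^+ t)).
    exact: cvg_divnr.
  by apply: cvg_expr; rewrite ger0_norm.
Unshelve. all: end_near.
Qed.

Lemma cvg0_of_natM (a : nat -> R) (x : R) :
  n%:R * a n @[n --> \oo] --> x -> a n @[n --> \oo] --> (0 : R).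
Proof.
move=> ax; have na : n%:R^-1 * (n%:R * a n) @[n --> \oo] --> (0 : R).
  rewrite -[X in _ --> X](mul0r x); apply: cvgM => //.
  apply/gtr0_cvgV0; last exact: cvgr_idn.
  by near=> n; rewrite ltr0n; near: n; exists 1%N.
apply: cvg_trans na; apply: near_eq_cvg; near=> n.
by rewrite mulKf// pnatr_eq0 -lt0n; near: n; exists 1%N.
Unshelve. all: end_near.
Qed.

(** Squeeze from [1 + y <= expR y]: taking [y = - a] gives the upper bound, and taking
    [y = a / (1 - a)], where [1 + y = (1 - a)^-1], gives the lower one after inversion. *)
Lemma cvg_onem_exp (a : nat -> R) (x : R) : (forall n, 0 <= a n) ->
  n%:R * a n @[n --> \oo] --> x ->
  (1 - a n) ^+ n @[n --> \oo] --> expR (- x).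
Proof.
move=> a0 ax.
have ca0 := cvg0_of_natM ax.
apply: (@squeeze_cvgr _ _ _ _ (fun n => expR (- (n%:R * a n / (1 - a n))))
  (fun n => expR (- (n%:R * a n)))).
- near=> n.
  have an1 : a n < 1 by near: n; exact: (cvgr_lt 0).
  have an : 0 < 1 - a n by rewrite subr_gt0.
  apply/andP; split.
    rewrite -mulrA -mulrN expRM_natl lerXn2r ?nnegrE ?expR_ge0 ?(ltW an)//.
    rewrite expRN -[leRHS]invrK lef_pV2 ?posrE ?expR_gt0 ?invr_gt0//.
    apply: le_trans (expR_ge1Dx _); rewrite le_eqVlt; apply/orP; left.
    by apply/eqP; field; rewrite gt_eqF.
  rewrite -mulrN expRM_natl lerXn2r ?nnegrE ?expR_ge0 ?(ltW an)//.
  exact: expR_ge1Dx.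
- have c : - (n%:R * a n / (1 - a n)) @[n --> \oo] --> - x.
    apply: cvgN; rewrite -[X in _ --> X]divr1; apply: cvgM => //.
    apply: cvgV; first by rewrite oner_neq0.
    by rewrite -[X in _ --> X]subr0; apply: cvgB => //; exact: cvg_cst.
  by apply: cvg_comp c _; exact: continuous_expR.
- apply: (@cvg_comp _ _ _ _ expR _ (nbhs (- x))); last exact: continuous_expR.
  exact: cvgN.
Unshelve. all: end_near.
Qed.

Lemma sum_ltn_ord (n b : nat) : (\sum_(i < n) (i < b) = minn n b)%N.
Proof.
elim: n => [|n ih]; first by rewrite big_ord0 min0n.
by rewrite big_ord_recr/= ih; case: (ltnP n b) => ? /=; lia.
Qed.

(* Freeze [k]: up to the errors [a n m - a n k * w n m] the recursion for [w n]
   is [w n m.+1 = (1 - a n k) * w n m].  The gap [t] is [n %/ k.+1], so that its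
   cost [n * d n * (t * d n)] vanishes as [k] grows, and [n * rho ^+ t] as [n]
   grows. *)
Lemma recursion_cvg_expR (s C rho lim_th : R) (N0 : nat) (K th d : nat -> R)
    (w a : nat -> nat -> R) :
  0 <= C -> 0 <= rho < 1 ->
  (forall n, w n 0%N = 1) ->
  (forall n m, w n m.+1 = w n m - a n m) ->
  (forall n m, 0 <= w n m) ->
  (forall n m, 0 <= a n m <= d n) ->
  (forall n m k t, (N0 <= k)%N -> (N0 <= t)%N -> (k + t <= m)%N ->
    `|a n m - a n k * w n m|
      <= d n * (C * ((k + t)%:R * d n) + C * rho ^+ k) + K k * rho ^+ t) ->
  n%:R * d n @[n --> \oo] --> s ->
  (forall k, n%:R * a n k @[n --> \oo] --> s * th k) ->
  th k @[k --> \oo] --> lim_th ->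
  w n n @[n --> \oo] --> expR (- (lim_th * s)).
Proof.
move=> C0 /andP[rho0 rho1] w0 wS w_ge0 ad err ds ath thl.
have a0 n m : 0 <= a n m by case/andP: (ad n m).
have adn n m : a n m <= d n by case/andP: (ad n m).
have d0 n : 0 <= d n := le_trans (a0 n 0%N) (adn n 0%N).
have w1 n m : w n m <= 1.
  elim: m => [|m ih]; first by rewrite w0.
  by rewrite wS; apply: le_trans ih; rewrite lerBlDr lerDl.
(* Both quantities lie in [[0, d n]]. This crude bound serves for the first [k + t] times, where the
   gap does not fit. *)
have aw n k m : `|a n m - a n k * w n m| <= d n.
  rewrite ler_distlC; apply/andP; split.
    by apply: (@le_trans _ _ 0); [rewrite subr_le0|exact: mulr_ge0].
  apply: (@le_trans _ _ (d n)); last by rewrite lerDr.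
  by apply: le_trans (adn n k); rewrite ler_piMr.
have cd0 := cvg0_of_natM ds.
pose E k t n := d n * (C * ((k + t)%:R * d n) + C * rho ^+ k) + `|K k| * rho ^+ t.
pose D k t n := (k + t)%:R * d n + n%:R * E k t n.
have E0 k t n : 0 <= E k t n.
  by rewrite /E addr_ge0 ?mulr_ge0 ?addr_ge0 ?mulr_ge0 ?exprn_ge0.
have wD n k t : (N0 <= k)%N -> (N0 <= t)%N -> a n k <= 1 ->
    `|w n n - (1 - a n k) ^+ n| <= D k t n.
  move=> Nk Nt ak1.
  pose e m := if (m < k + t)%N then d n else E k t n.
  have eb m : `|a n m - a n k * w n m| <= e m.
    rewrite /e; case: ltnP => [_|ktm]; first exact: aw.
    apply: le_trans (err _ _ _ _ Nk Nt ktm) _.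
    by rewrite lerD2l ler_wpM2r ?exprn_ge0// ler_norm.
  (* Errors only add up, because each step multiplies the previous discrepancy by [1 - a n k], which
     lies in [[0, 1]]. *)
  have sum_e m : `|w n m - (1 - a n k) ^+ m| <= \sum_(i < m) e i.
    elim: m => [|m ih]; first by rewrite w0 expr0 subrr normr0 big_ord0.
    rewrite big_ord_recr/= wS exprS.
    have -> : w n m - a n m - (1 - a n k) * (1 - a n k) ^+ m =
        (1 - a n k) * (w n m - (1 - a n k) ^+ m) - (a n m - a n k * w n m).
      by ring.
    apply: le_trans (ler_normB _ _) _; apply: lerD => //.
    apply: le_trans ih; rewrite normrM ger0_norm ?subr_ge0//.
    by rewrite ler_piMl// lerBlDr lerDl.
  apply: le_trans (sum_e n) _.
  apply: (@le_trans _ _ (\sum_(i < n) ((i < k + t)%:R * d n + E k t n))).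
    apply: ler_sum => i _; rewrite /e; case: ifP => _; rewrite ?mul1r ?mul0r ?add0r//.
    by rewrite lerDl.
  rewrite big_split/= sumr_const card_ord /D -[_ *+ n]mulr_natl lerD2r.
  rewrite -mulr_suml ler_wpM2r// -natr_sum ler_nat.
  by rewrite sum_ltn_ord geq_minr.
(* [F] replaces the floor [n %/ k.+1] by the real quotient, so that the bound has an explicit limit
   in [n]. *)
have cD k : exists2 F : nat -> R,
    (forall n, D k (n %/ k.+1)%N n <= F n) &
    F n @[n --> \oo] --> s / k.+1%:R + C * s * (s / k.+1%:R) + C * s * rho ^+ k.
  exists (fun n => (k%:R * d n + n%:R * d n / k.+1%:R)
    + C * (n%:R * d n) * (k%:R * d n + n%:R * d n / k.+1%:R)
    + C * (n%:R * d n) * rho ^+ k + `|K k| * (n%:R * rho ^+ (n %/ k.+1))).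
    move=> n; set t := (n %/ k.+1)%N.
    have ktd : (k + t)%:R * d n <= k%:R * d n + n%:R * d n / k.+1%:R.
      rewrite natrD mulrDl lerD2l [leRHS]mulrAC ler_wpM2r//.
      by rewrite ler_pdivlMr ?ltr0n// -natrM ler_nat leq_trunc_div.
    rewrite /D /E.
    have -> : n%:R * (d n * (C * ((k + t)%:R * d n) + C * rho ^+ k) +
        `|K k| * rho ^+ t) = C * (n%:R * d n) * ((k + t)%:R * d n) +
        C * (n%:R * d n) * rho ^+ k + `|K k| * (n%:R * rho ^+ t) by ring.
    rewrite !addrA !lerD2r; apply: lerD => //.
    by rewrite ler_wpM2l// !mulr_ge0.
  have kd : k%:R * d n + n%:R * d n / k.+1%:R @[n --> \oo] --> s / k.+1%:R.
    rewrite -[X in _ --> X]add0r; apply: cvgD; last by apply: cvgMl.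
    by rewrite -[X in _ --> X](mulr0 k%:R); apply: cvgMr.
  rewrite -[X in _ --> X]addr0; apply: cvgD; last first.
    rewrite -[X in _ --> X](mulr0 `|K k|); apply: cvgMr.
    by apply: cvg_natM_exp_divn; rewrite rho0.
  apply: cvgD; last by apply: cvgMl; exact: cvgMr.
  apply: cvgD => //; apply: cvgM => //; exact: cvgMr.
have cB : s / k.+1%:R + C * s * (s / k.+1%:R) + C * s * rho ^+ k
    @[k --> \oo] --> (0 : R).
  have sk : s / k.+1%:R @[k --> \oo] --> (0 : R).
    by rewrite -[X in _ --> X](mulr0 s); apply: cvgMr; exact: cvg_harmonic.
  have rk : rho ^+ k @[k --> \oo] --> (0 : R).
    by apply: cvg_expr; rewrite ger0_norm.
  have <- : 0 + C * s * 0 + C * s * 0 = 0 :> R by rewrite !mulr0 !addr0.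
  by apply: cvgD; [apply: cvgD => //|]; exact: cvgMr.
have cth : expR (- (s * th k)) @[k --> \oo] --> expR (- (lim_th * s)).
  apply: (@cvg_comp _ _ _ _ expR _ (nbhs (- (lim_th * s)))); last exact: continuous_expR.
  by apply: cvgN; rewrite mulrC; apply: cvgMr.
apply/cvgrPdist_lt => e e0.
have e4 : 0 < e / 4 by rewrite divr_gt0.
near \oo => k.
have [F DF cF] := cD k.
have Bk : s / k.+1%:R + C * s * (s / k.+1%:R) + C * s * rho ^+ k < e / 4.
  by near: k; exact: (cvgr_lt 0).
have Tk : `|expR (- (lim_th * s)) - expR (- (s * th k))| < e / 4.
  by near: k; move/cvgrPdist_lt : cth; exact.
have Nk : (N0 <= k)%N by near: k; exists N0.
near=> n.
have Fn : F n < e / 4 by near: n; exact: (cvgr_lt _ cF).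
have Xn : `|expR (- (s * th k)) - (1 - a n k) ^+ n| < e / 4.
  near: n; have /cvgrPdist_lt := cvg_onem_exp (a0 ^~ k) (ath k); exact.
have Nt : (N0 <= n %/ k.+1)%N.
  by near: n; apply: (@cvg_divnr k.+1 (ltn0Sn k) [set t | (N0 <= t)%N]); exists N0.
have an1 : a n k <= 1.
  apply: le_trans (adn _ _) _; apply: ltW; near: n.
  by apply: (cvgr_lt 0).
have := wD n k _ Nk Nt an1; rewrite distrC => H.
have {}H := le_trans H (DF n).
have -> : expR (- (lim_th * s)) - w n n =
   (expR (- (lim_th * s)) - expR (- (s * th k)))
   + (expR (- (s * th k)) - (1 - a n k) ^+ n)
   + ((1 - a n k) ^+ n - w n n) by ring.
apply: le_lt_trans (ler_normD _ _) _.
apply: le_lt_trans (lerD (ler_normD _ _) (lexx _)) _.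
lra.
Unshelve. all: end_near.
Qed.

End real_analysis.

(** * Lebesgue measure of boxes, balls and tubes *)

Section boxes.
Context {R : realType}.

Lemma measurable_box n (A : 'I_n -> set R) :
  (forall i, measurable (A i : set (measurableTypeR R))) ->
  measurable [set x : Rq R n | forall i, A i (tnth x i)].
Proof.
move=> mA.
have -> : [set x : Rq R n | forall i, A i (tnth x i)] =
    \bigcap_(i in [set: 'I_n]) ((fun x => tnth x i) @^-1` A i).
  by apply/seteqP; split => [x Ax i _|x Ax i]; [exact: Ax|exact: Ax].
apply: fin_bigcap_measurable => // i _.
rewrite -[X in measurable X]setTI; exact: measurable_tnth.
Qed.

Lemma measurable_cube n : measurable (@cube R n).
Proof.
apply: (@measurable_box n (fun=> `[0, 1]%classic)) => i; exact: measurable_itv.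
Qed.

Lemma lebn_box n (A : 'I_n -> set R) :
  (forall i, measurable (A i : set (measurableTypeR R))) ->
  lebn n [set x : Rq R n | forall i, A i (tnth x i)] =
  (\prod_(i < n) (@lebesgue_measure R) (A i))%E.
Proof.
elim: n A => [|n ih] A mA.
  by rewrite big_ord0 /= diracE mem_set// => -[].
rewrite big_ord_recl -ih//.
have mB := @measurable_box n (fun i => A (lift ord0 i)) (fun i => mA _).
rewrite -(@product_measure1E _ _ _ _ R lebesgue_measure (lebn n) _ _ (mA ord0) mB).
rewrite /= /leb_step /pushforward; congr (_ _).
apply/seteqP; split => [[a t]|[a t]]/=.
  move=> H; split; first exact: (H ord0).
  by move=> i; have := H (lift ord0 i); rewrite tnthS.
move=> [Aa At] i; case: (unliftP ord0 i) => [j ->|->//].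
by rewrite tnthS.
Qed.

Lemma lebn_cube n : lebn n (@cube R n) = 1%E.
Proof.
rewrite (@lebn_box n (fun=> `[0, 1]%classic)) => [|i]; last exact: measurable_itv.
rewrite big1// => i _.
by rewrite lebesgue_measure_itv/= lte_fin ltr01 sube0.
Qed.

Lemma measurable_sublevel d (X : measurableType d) (f : X -> R) (e : R) :
  measurable_fun setT f -> measurable [set x | f x < e].
Proof.
move=> mf; have := mf measurableT `]-oo, e[%classic (measurable_itv _).
by rewrite setTI; congr measurable; apply/seteqP; split => x /=; rewrite in_itv.
Qed.

Lemma measurable_eball_graph n (e : R) :
  measurable [set p : Rq R n * Rq R n | eball p.1 e p.2].
Proof.
have mf : measurable_fun setT (fun p : Rq R n * Rq R n =>
   Num.sqrt (\sum_(i < n) (tnth p.2 i - tnth p.1 i) ^+ 2)).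
  apply: measurableT_comp.
    by apply: continuous_measurable_fun; exact: sqrt_continuous.
  apply: measurable_sum => i.
  apply: measurable_funX; apply: measurable_funB.
    exact: (measurableT_comp (measurable_tnth i) measurable_snd).
  exact: (measurableT_comp (measurable_tnth i) measurable_fst).
exact: measurable_sublevel.
Qed.

Lemma measurable_eball n (x : Rq R n) e : measurable (eball x e).
Proof.
have := measurable_xsection x (measurable_eball_graph (n := n) e).
congr measurable.
by apply/seteqP; split => y; rewrite /xsection/= inE.
Qed.

Lemma eballC n (x y : Rq R n) e : eball x e y -> eball y e x.
Proof.
rewrite /eball/=; under eq_bigr do rewrite -sqrrN opprB.
by [].
Qed.

Lemma eball_coord n (x y : Rq R n) e i : eball x e y -> `|tnth y i - tnth x i| < e.
Proof.
apply: le_lt_trans; rewrite -sqrtr_sqr ler_wsqrtr// (bigD1 i)//= lerDl.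
by apply: sumr_ge0 => j _; exact: sqr_ge0.
Qed.

Lemma box_eball n (x y : Rq R n) (dl e : R) :
  (forall i, `|tnth y i - tnth x i| <= dl) -> dl * n%:R < e -> eball x e y.
Proof.
move=> H; apply: le_lt_trans.
case: n x y H => [|n] x y H; first by rewrite big_ord0 sqrtr0 mulr0.
have dl0 : 0 <= dl := le_trans (normr_ge0 _) (H ord0).
have -> : dl * n.+1%:R = Num.sqrt ((dl * n.+1%:R) ^+ 2).
  by rewrite sqrtr_sqr ger0_norm// mulr_ge0.
rewrite ler_wsqrtr//; apply: (@le_trans _ _ (\sum_(i < n.+1) dl ^+ 2)).
  by apply: ler_sum => i _; rewrite -[leLHS]real_normK ?num_real// lerXn2r ?nnegrE.
rewrite sumr_const card_ord -[_ *+ n.+1]mulr_natr exprMn ler_wpM2l ?sqr_ge0//.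
by rewrite -natrX ler_nat expnS expn1 leq_pmulr.
Qed.

(** Coordinates of [y] and [z] differ by at most [e / n.+1], and [box_eball] costs a factor [n];
    [n.+1] keeps the final inequality strict and covers [n = 0]. *)
Lemma eball_subset n (x y z : Rq R n) e : 0 < e ->
  eball x (e / (2 * n.+1%:R)) y -> eball x (e / (2 * n.+1%:R)) z ->
  eball y e z.
Proof.
move=> e0 xy xz; apply: (@box_eball _ _ _ (e / n.+1%:R)).
  move=> i; have := eball_coord i xy; have := eball_coord i xz.
  rewrite invfM mulrA mulrAC; set d := e / n.+1%:R => H1 H2.
  have -> : tnth z i - tnth y i = (tnth z i - tnth x i) - (tnth y i - tnth x i) by ring.
  by apply: le_trans (ler_normB _ _) _; lra.
by rewrite mulrAC ltr_pdivrMr// ltr_pM2l// ltr_nat.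
Qed.

(** A ball centred near the boundary may leave the cube, but the box with a corner at [x] whose
    sides of length [dl <= 1 / 2] point towards the middle of the cube stays in both. Its volume
    does not depend on [x]. *)
Lemma eball_cube_lower n (e : R) : 0 < e ->
  exists2 v : R, 0 < v &
    forall x : Rq R n, cube x -> (v%:E <= lebn n (eball x e `&` @cube R n))%E.
Proof.
move=> e0; pose dl := Num.min (e / n.+1%:R) 1 / 2.
have dl0 : 0 < dl by rewrite divr_gt0// lt_min ltr01 andbT divr_gt0.
have dl1 : dl <= 1 / 2 by rewrite ler_pM2r ?invr_gt0// ge_min lexx orbT.
have dle : dl * n%:R < e.
  apply: (@lt_le_trans _ _ (dl * n.+1%:R)); first by rewrite ltr_pM2l// ltr_nat.
  rewrite -ler_pdivlMr//; apply: (@le_trans _ _ (Num.min (e / n.+1%:R) 1)).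
    by rewrite /dl ler_piMr ?le_min ?divr_ge0 ?ler01 ?(ltW e0)//; lra.
  by rewrite ge_min lexx.
exists (dl ^+ n); first exact: exprn_gt0.
move=> x cx.
pose A (i : 'I_n) : set R := if tnth x i <= 1 / 2 then `[tnth x i, tnth x i + dl]%classic
  else `[tnth x i - dl, tnth x i]%classic.
have mA i : measurable (A i : set (measurableTypeR R)).
  by rewrite /A; case: ifP => _; exact: measurable_itv.
have AE i : lebesgue_measure (A i) = dl%:E.
  rewrite /A; case: ifP => _; rewrite lebesgue_measure_itv/= lte_fin.
    by rewrite ltrDl dl0 -EFinD addrAC subrr add0r.
  by rewrite gtrBl dl0 -EFinD opprB addrCA subrr addr0.
have Ax i t : A i t -> `|t - tnth x i| <= dl /\ t \in `[0, 1].
  have := cx i; rewrite !in_itv/= ler_distlC => /andP[x0 x1].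
  rewrite /A; case: (leP (tnth x i) (1 / 2)) => xh /=; rewrite in_itv/= => /andP[? ?];
    by split; apply/andP; split; lra.
apply: (@le_trans _ _ (lebn n [set y : Rq R n | forall i, A i (tnth y i)])).
  rewrite lebn_box// (eq_bigr (fun=> dl%:E))// prodEFin prodr_const card_ord.
  exact: lexx.
apply: le_measure; rewrite ?inE.
- exact: measurable_box.
- by apply: measurableI; [exact: measurable_eball|exact: measurable_cube].
- move=> y Ay; split; last by move=> i; have [] := Ax _ _ (Ay i).
  by apply: box_eball dle => i; have [] := Ax _ _ (Ay i).
Qed.

Lemma lebesgue_ball_le (a d : R) : 0 <= d ->
  (lebesgue_measure (`](a - d)%R, (a + d)%R[%classic : set R) <= (2 * d)%:E)%E.
Proof.
move=> d0; rewrite lebesgue_measure_itv/= lte_fin; case: ifP => _.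
  by rewrite -EFinD lee_fin; lra.
by rewrite lee_fin mulr_ge0.
Qed.

Lemma measurable_annulus (a r e : R) :
  measurable ([set t | `| `|a - t| - r| < e] : set (measurableTypeR R)).
Proof.
have mf : measurable_fun setT (fun t : measurableTypeR R => `| `|a - t| - r|).
  apply: measurableT_comp => //; apply: measurable_funB => //.
  apply: measurableT_comp => //; exact: measurable_funB.
exact: measurable_sublevel.
Qed.

Lemma lebesgue_annulus_le (a r e : R) : 0 <= e ->
  (lebesgue_measure [set t : R | (`| `|a - t| - r| < e)%R] <= (4 * e)%:E)%E.
Proof.
move=> e0; apply: (@le_trans _ _
  (lebesgue_measure (`]((a - r) - e)%R, ((a - r) + e)%R[%classic `|`
                     `]((a + r) - e)%R, ((a + r) + e)%R[%classic : set R))).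
  apply: le_measure; rewrite ?inE; first exact: measurable_annulus.
    by apply: measurableU; exact: measurable_itv.
  move=> t /=; rewrite !in_itv/= ltr_distl => /andP[].
  case: (ger0P (a - t)) => [?|?] *; [left|right]; apply/andP; split; lra.
apply: le_trans (measureU2 _ _ _) _; rewrite ?measurable_itv//.
have -> : (4 * e)%:E = ((2 * e)%:E + (2 * e)%:E)%E by rewrite -EFinD; congr EFin; ring.
by apply: leeD; exact: lebesgue_ball_le.
Qed.

Lemma measurable_tube n (j : 'I_n) (r e : R) : measurable (@cube R n.+1 `&`
     [set x : Rq R n.+1 | (`| `|tnth x ord0 - tnth x (lift ord0 j)| - r| < e)%R]).
Proof.
apply: measurableI; first exact: measurable_cube.
have mf : measurable_fun setT (fun x : Rq R n.+1 =>
   `| `|tnth x ord0 - tnth x (lift ord0 j)| - r|).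
  apply: measurableT_comp => //; apply: measurable_funB => //.
  apply: measurableT_comp => //.
  by apply: measurable_funB; exact: measurable_tnth.
exact: measurable_sublevel.
Qed.

(** Fubini in the first coordinate: once it is fixed at [a], the slice lies in a box whose [j]-th
    side is an annulus around [a] (two intervals of length [2 * e]) and whose other sides are unit
    intervals. *)
Lemma lebn_tube_coord_le n (j : 'I_n) (r e : R) : 0 <= e ->
  (lebn n.+1 (@cube R n.+1 `&`
     [set x : Rq R n.+1 | (`| `|tnth x ord0 - tnth x (lift ord0 j)| - r| < e)%R]) <= (4 * e)%:E)%E.
Proof.
move=> e0; set S := _ `&` _.
have mS : measurable S := measurable_tube j r e.
have mS' : measurable (@tcons R n @^-1` S).
  by rewrite -[X in measurable X]setTI; exact: measurable_tcons.
have -> : lebn n.+1 S = (\int[lebesgue_measure]_a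
   (lebn n (xsection (@tcons R n @^-1` S) a)))%E by [].
pose I01 : set (measurableTypeR R) := `[0, 1]%classic.
apply: (@le_trans _ _ (\int[lebesgue_measure]_(a in I01) (cst (4 * e)%:E a))%E); last first.
  have I01E : lebesgue_measure I01 = 1%E.
    by rewrite lebesgue_measure_itv/= lte_fin ltr01 sube0.
  rewrite integral_cst; last exact: measurable_itv.
  by rewrite [X in (_ * X)%E]I01E mule1.
rewrite [leRHS]integral_mkcond; apply: ge0_le_integral => //.
- exact: measurable_fun_xsection.
- have mc : measurable_fun I01 (cst (4 * e)%:E) by exact: measurable_cst.
  exact: ((measurable_restrictT _ (measurable_itv _)).1 mc).
move=> a _; rewrite patchE; case: ifPn => [_|].
  pose A (i : 'I_n) : set (measurableTypeR R) :=
    if i == j then [set t | `| `|a - t| - r| < e] else `[0, 1]%classic.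
  have mA i : measurable (A i).
    by rewrite /A; case: ifP => _; [exact: measurable_annulus|exact: measurable_itv].
  apply: (@le_trans _ _ (lebn n [set y : Rq R n | forall i, A i (tnth y i)])).
    apply: le_measure; rewrite ?inE.
    - exact: measurable_xsection.
    - exact: measurable_box.
    - move=> t; rewrite /xsection/= inE => -[ct /=]; rewrite tnthS/= => jt i.
      rewrite /A; case: eqP => [->//|_].
      by have := ct (lift ord0 i); rewrite tnthS.
  rewrite lebn_box// (bigD1 j)//= big1 ?mule1; last first.
    move=> i /negPf ij; rewrite /A ij.
    by rewrite lebesgue_measure_itv/= lte_fin ltr01 sube0.
  by rewrite /A eqxx; exact: lebesgue_annulus_le.
move=> aI; rewrite (_ : xsection _ _ = set0) ?measure0//.
apply/seteqP; split => // t; rewrite /xsection/= inE => -[ct _].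
by move: aI; rewrite notin_setE; apply; exact: (ct ord0).
Qed.

End boxes.

(** * The distance to the diagonal *)

Section near_diagonal.
Context {R : realType}.

(* [psi x = expR (- phi x)], with [psi x = 0] when [phi x = +oo]. *)
Definition psi q (x : Rq R q) : R :=
  \big[Num.max/0]_(1 <= j < q) `|x`_0 - x`_j|.

Lemma psi_ge0 q (x : Rq R q) : 0 <= psi x.
Proof. by apply: bigmax_ge_id. Qed.

Lemma phi_gtE q (r : R) (x : Rq R q) : (r%:E < phi x)%E = (psi x < expR (- r)).
Proof.
rewrite /phi -/(psi x) lteNr -EFinN.
have := psi_ge0 x; rewrite le_eqVlt => /predU1P[<-|p0].
  by rewrite le0_lneNy// ltNyr expR_gt0.
by rewrite lne_EFin// lte_fin -[in LHS]ltr_expR lnK ?posrE.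
Qed.

Lemma psi_le q (x : Rq R q) (m : R) : 0 <= m ->
  (forall j, (1 <= j < q)%N -> `|x`_0 - x`_j| <= m) -> psi x <= m.
Proof.
by move=> m0 H; rewrite /psi big_nat_cond; apply: bigmax_le => // j /andP[/H].
Qed.

Lemma psi_coord_ge q (x : Rq R q) j : (1 <= j < q)%N -> `|x`_0 - x`_j| <= psi x.
Proof.
move=> jq; rewrite /psi.
apply: (le_bigmax_seq 0 j xpredT (fun j : nat => `|x`_0 - x`_j| : R)) => //.
by rewrite mem_index_iota.
Qed.

Lemma measurable_nth n (i : nat) : (i < n)%N ->
  measurable_fun [set: Rq R n] (fun x : Rq R n => x`_i : measurableTypeR R).
Proof.
move=> lin; have := @measurable_tnth _ (measurableTypeR R) n (Ordinal lin).
by congr measurable_fun; apply/funext => x; rewrite (tnth_nth 0).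
Qed.

Lemma measurable_psi q : measurable_fun [set: Rq R q] (@psi q).
Proof.
rewrite /psi.
have : {subset index_iota 1 q <= [pred j | (1 <= j < q)%N]}.
  by move=> j; rewrite mem_index_iota.
elim: (index_iota 1 q) => [|j s ih] Hs.
  by under eq_fun do rewrite big_nil; exact: measurable_cst.
under eq_fun do rewrite big_cons.
have /andP[j1 jq] : (1 <= j < q)%N by apply: Hs; rewrite mem_head.
apply: measurable_maxr.
  apply: measurableT_comp => //; apply: measurable_funB; apply: measurable_nth => //.
  exact: leq_trans jq.
by apply: ih => i si; apply: Hs; rewrite in_cons si orbT.
Qed.

(** The factor 2 appears because both coordinates in a difference may move by [e]. *)
Lemma psi_lip q (x y : Rq R q) (e : R) : eball x e y -> psi y <= psi x + 2 * e.
Proof.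
case: q x y => [|q] x y xy.
  have e0 : 0 < e by apply: le_lt_trans xy; exact: sqrtr_ge0.
  by rewrite {1}/psi big_geq// addr_ge0 ?psi_ge0// mulr_ge0// ltW.
have c j : (j < q.+1)%N -> `|y`_j - x`_j| < e.
  by move=> jq; have := eball_coord (Ordinal jq) xy; rewrite !(tnth_nth 0).
have e0 : 0 < e by apply: le_lt_trans (c 0%N isT).
apply: psi_le => [|j /[dup] jq /andP[j1 jq1]].
  by rewrite addr_ge0 ?psi_ge0// mulr_ge0// ltW.
have -> : y`_0 - y`_j = (x`_0 - x`_j) + ((y`_0 - x`_0) - (y`_j - x`_j)) by ring.
apply: le_trans (ler_normD _ _) _; apply: lerD; first exact: psi_coord_ge.
apply: le_trans (ler_normB _ _) _; have := c 0%N isT; have := c j jq1; lra.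
Qed.

Lemma measure_bigsetU_le d (X : measurableType d) (mu : {measure set X -> \bar R})
    (I : Type) (s : seq I) (F : I -> set X) : (forall i, measurable (F i)) ->
  (mu (\big[setU/set0]_(i <- s) F i) <= \sum_(i <- s) mu (F i))%E.
Proof.
move=> mF; elim: s => [|i s ih]; first by rewrite !big_nil measure0.
rewrite !big_cons; apply: le_trans (measureU2 _ _ _) _ => //.
  exact: bigsetU_measurable.
exact: leeD.
Qed.

Lemma measurable_psi_annulus q (r e : R) :
  measurable (@cube R q `&` [set x | `|psi x - r| < e]).
Proof.
apply: measurableI; first exact: measurable_cube.
have mf : measurable_fun setT (fun x : Rq R q => `|psi x - r|).
  apply: measurableT_comp => //; apply: measurable_funB => //; exact: measurable_psi.
exact: measurable_sublevel.
Qed.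

(** Since [psi] is a maximum, all the distances are below [r + e] and one of them exceeds [r - e],
    so the set is covered by [q - 1] tubes. If [r - e < 0] any index works, and [2 <= q] provides
    one. The bound does not involve [r], whence the uniformity over the targets. *)
Lemma lebn_psi_annulus_le q (r e : R) : (2 <= q)%N -> 0 < e ->
  (lebn q (@cube R q `&` [set x | (`|psi x - r| < e)%R]) <= (q%:R * (4 * e))%:E)%E.
Proof.
case: q => [|[|n]]// _ e0.
pose F (j : 'I_n.+1) := @cube R n.+2 `&`
     [set x : Rq R n.+2 | (`| `|tnth x ord0 - tnth x (lift ord0 j)| - r| < e)%R].
apply: (@le_trans _ _ (lebn n.+2 (\big[setU/set0]_(j < n.+1) F j))).
  apply: le_measure; rewrite ?inE; first exact: measurable_psi_annulus.
    by apply: bigsetU_measurable => j _; exact: measurable_tube.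
  move=> x [cx /=]; rewrite ltr_distl => /andP[rx xr].
  have tE j : tnth x (lift ord0 j) = x`_j.+1 by rewrite (tnth_nth 0).
  have t0 : tnth x ord0 = x`_0 by rewrite (tnth_nth 0).
  have up (j : 'I_n.+1) : `|x`_0 - x`_j.+1| < r + e.
    by apply: le_lt_trans xr; apply: psi_coord_ge; exact: (ltn_ord j).
  suff [j Hj] : exists j : 'I_n.+1, r - e < `|x`_0 - x`_j.+1|.
    rewrite -bigcup_seq; exists j => /=; first by rewrite mem_index_enum.
    by split => //=; rewrite t0 tE ltr_distl Hj up.
  have [re0|re0] := ltP (r - e) 0.
    by exists ord0; exact: lt_le_trans (normr_ge0 _).
  apply: contrapT => /forallNP H.
  have : psi x <= r - e.
    apply: psi_le => // -[//|j] /andP[_ jn].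
    by have := H (@Ordinal n.+1 j jn) => /negP; rewrite -leNgt.
  by rewrite leNgt rx.
apply: le_trans (measure_bigsetU_le _ _ _) _ => [j|]; first exact: measurable_tube.
apply: (@le_trans _ _ (\sum_(j < n.+1) (4 * e)%:E)%E).
  by apply: lee_sum => j _; apply: lebn_tube_coord_le; exact: ltW.
rewrite sumEFin lee_fin sumr_const card_ord -[_ *+ n.+1]mulr_natl.
by rewrite ler_wpM2r ?ler_nat// mulr_ge0// ltW.
Qed.

End near_diagonal.

(** * Lower integrals and oscillations *)

Section lower_integral.
Context d (X : measurableType d) (R : realType).
Variable mu : {measure set X -> \bar R}.
Variables (D : set X) (mD : measurable D).
Import HBNNSimple.
Local Open Scope ereal_scope.

(* The integral of a nonnegative function is a supremum over the simple
   functions below it, so the next lemmas need no measurability: [osc] is not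
   known to be measurable. *)
Lemma ge0_le_lower_integral (f g : X -> \bar R) :
  (forall x, D x -> 0 <= f x) -> (forall x, D x -> f x <= g x) ->
  \int[mu]_(x in D) f x <= \int[mu]_(x in D) g x.
Proof.
move=> f0 fg; have g0 x : D x -> 0 <= g x.
  by move=> Dx; apply: le_trans (fg x Dx); exact: f0.
rewrite !ge0_integralE//; apply: ge_ereal_sup => _ [k kf <-].
apply: ereal_sup_ubound; exists k => // x; apply: le_trans (kf x) _.
by rewrite !patchE; case: ifPn => // /set_mem; exact: fg.
Qed.

Lemma lower_integral_le (f : X -> \bar R) (M : \bar R) :
  (forall x, D x -> 0 <= f x) ->
  (forall k : X -> R, measurable_fun setT k -> (forall x, 0 <= k x)%R ->
    (forall x, D x -> (k x)%:E <= f x) -> \int[mu]_(x in D) (k x)%:E <= M) ->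
  \int[mu]_(x in D) f x <= M.
Proof.
move=> f0 H; rewrite ge0_integralE//; apply: ge_ereal_sup => _ [k kf <-].
rewrite -integralT_nnsfun.
have -> : \int[mu]_x (k x)%:E = \int[mu]_(x in D) (k x)%:E.
  rewrite [RHS]integral_mkcond; apply: eq_integral => x _.
  rewrite patchE; case: ifPn => // xD.
  apply/le_anti/andP; split; last by rewrite lee_fin fun_ge0.
  by have := kf x; rewrite patchE (negPf xD).
apply: H => //= x Dx; have := kf x; by rewrite patchE mem_set.
Qed.

(** Lower integrals are in general only superadditive. Here [g] is measurable, so a measurable [k]
    below [f + g] yields the measurable minorant [max (k - g) 0] of [f]. *)
Lemma lower_integralD_le (f : X -> \bar R) (g : X -> R) :
  (forall x, D x -> 0 <= f x) -> (forall x, D x -> 0 <= g x)%R ->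
  measurable_fun D g ->
  \int[mu]_(x in D) (f x + (g x)%:E) <=
  \int[mu]_(x in D) f x + \int[mu]_(x in D) (g x)%:E.
Proof.
move=> f0 g0 mg; apply: lower_integral_le => [x Dx|k mk k0 kfg].
  by rewrite adde_ge0 ?lee_fin ?f0 ?g0.
have mk' : measurable_fun D k by exact: measurable_funTS.
apply: (@le_trans _ _ (\int[mu]_(x in D)
   ((Num.max (k x - g x) 0)%:E + (g x)%:E))).
  apply: ge0_le_lower_integral => [x _|x Dx]; first by rewrite lee_fin.
  by rewrite -EFinD lee_fin -lerBlDr le_max lexx.
rewrite ge0_integralD//.
- rewrite leeD2r//; apply: ge0_le_lower_integral => [x _|x Dx].
    by rewrite lee_fin le_max lexx orbT.
  rewrite EFin_max ge_max f0// andbT EFinB leeBlDr//.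
  exact: kfg.
- by move=> x _; rewrite lee_fin le_max lexx orbT.
- apply/measurable_EFinP; apply: measurable_maxr => //; exact: measurable_funB.
- exact/measurable_EFinP.
Qed.

Lemma lower_integralZl_le (f : X -> \bar R) (c : R) : (0 < c)%R ->
  (forall x, D x -> 0 <= f x) ->
  \int[mu]_(x in D) (c%:E * f x) <= c%:E * \int[mu]_(x in D) f x.
Proof.
move=> c0 f0; apply: lower_integral_le => [x Dx|k mk k0 kcf].
  by rewrite mule_ge0 ?lee_fin ?(ltW c0) ?f0.
have -> : \int[mu]_(x in D) (k x)%:E =
    c%:E * \int[mu]_(x in D) (c^-1 * k x)%:E.
  rewrite -ge0_integralZl//.
  - apply: eq_integral => x _; rewrite -EFinM mulrA mulfV ?mul1r//.
    by rewrite gt_eqF.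
  - apply/measurable_EFinP; apply: measurable_funM => //.
    exact: measurable_funTS.
  - by move=> x _; rewrite lee_fin mulr_ge0// invr_ge0 ltW.
  - by rewrite lee_fin ltW.
rewrite lee_pmul2l ?lte_fin//; apply: ge0_le_lower_integral => [x _|x Dx].
  by rewrite lee_fin mulr_ge0// invr_ge0 ltW.
by rewrite EFinM lee_pdivrMl//; exact: kcf.
Qed.

End lower_integral.

Section oscillation.
Context {R : realType} (q : nat).
Local Notation m := (lebn q : {measure set (Rq R q) -> \bar R}).
Local Notation cube := (@cube R q).
Implicit Types (f g : Rq R q -> R) (B : set (Rq R q)) (x y : Rq R q).
Local Open Scope ereal_scope.

Lemma ae_nonempty (A : set (Rq R q)) (P : Rq R q -> Prop) : measurable A ->
  0 < m A -> {ae m, forall x, A x -> P x} -> exists2 x, A x & P x.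
Proof.
move=> mA A0 [N [mN N0 PN]]; apply: contrapT => H.
have : m A <= m N.
  apply: le_measure; rewrite ?inE// => x Ax; apply: PN => /= Px.
  by apply: H; exists x => //; exact: Px.
by rewrite N0 leNgt A0.
Qed.

Definition osc_sup f B := ess_sup m (fun x => if x \in B `&` cube then (f x)%:E else -oo).
Definition osc_inf f B := ess_inf m (fun x => if x \in B `&` cube then (f x)%:E else +oo).

Lemma oscE f B : osc f B = osc_sup f B - osc_inf f B.
Proof. by []. Qed.

Lemma osc_sup_ge f B : {ae m, forall x, (B `&` cube) x -> (f x)%:E <= osc_sup f B}.
Proof.
have := ess_sup_ge m (fun x => if x \in B `&` cube then (f x)%:E else -oo).
by apply: filterS => x + Bx; rewrite mem_set.
Qed.

Lemma osc_inf_le f B : {ae m, forall x, (B `&` cube) x -> osc_inf f B <= (f x)%:E}.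
Proof.
have := ess_inf_le m (fun x => if x \in B `&` cube then (f x)%:E else +oo).
by apply: filterS => x + Bx; rewrite mem_set.
Qed.

(** A finite value between the two essential bounds rules out indeterminate differences in [osc] and
    fixes its sign. *)
Lemma osc_witness f B : measurable (B `&` cube) -> 0 < m (B `&` cube) ->
  exists y, [/\ (B `&` cube) y, osc_inf f B <= (f y)%:E & (f y)%:E <= osc_sup f B].
Proof.
move=> mB B0.
have [|y By [? ?]] := @ae_nonempty _
  (fun y => osc_inf f B <= (f y)%:E /\ (f y)%:E <= osc_sup f B) mB B0.
  by apply: filterS2 (osc_inf_le f B) (osc_sup_ge f B) => y H1 H2 By; split; auto.
by exists y.
Qed.

Lemma osc_ge0 f B : measurable (B `&` cube) -> 0 < m (B `&` cube) -> 0 <= osc f B.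
Proof.
move=> mB B0; have [y [_ Iy yS]] := osc_witness f mB B0.
by rewrite oscE; have := leeB yS Iy; rewrite -EFinB subrr.
Qed.

Lemma osc_le f B (a b : R) :
  {ae m, forall x, (B `&` cube) x -> (a <= f x <= b)%R} -> osc f B <= (b - a)%:E.
Proof.
move=> H; rewrite oscE EFinB; apply: leeB.
  apply/ess_supP; apply: filterS H => x Hx; case: ifPn => [/set_mem/Hx/andP[_]|_].
    by rewrite lee_fin.
  exact: leNye.
apply/ess_infP; apply: filterS H => x Hx; case: ifPn => [/set_mem/Hx/andP[]|_].
  by rewrite lee_fin.
exact: leey.
Qed.

Lemma eq_osc f g B : (forall x, (B `&` cube) x -> f x = g x) -> osc f B = osc g B.
Proof.
move=> fg; rewrite !oscE; congr (_ - _).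
  by congr (ess_sup _ _); apply/funext => x; case: ifPn => // /set_mem/fg ->.
by congr (ess_inf _ _); apply/funext => x; case: ifPn => // /set_mem/fg ->.
Qed.

Lemma oscZ f B (c : R) : measurable (B `&` cube) -> 0 < m (B `&` cube) -> (0 < c)%R ->
  osc (fun x => c * f x)%R B = c%:E * osc f B.
Proof.
move=> mB B0 c0; have [y [_ Iy yS]] := osc_witness f mB B0.
rewrite !oscE muleBr//; last first.
  rewrite /adde_def; case: (osc_inf f B) Iy; case: (osc_sup f B) yS => //.
congr (_ - _).
  rewrite /osc_sup -ess_sup_pZl//; congr (ess_sup _ _); apply/funext => x /=.
  by case: ifP => // _; rewrite gt0_muleNy// lte_fin.
rewrite /osc_inf -ess_inf_pZl//; congr (ess_inf _ _); apply/funext => x /=.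
by case: ifP => // _; rewrite gt0_muley// lte_fin.
Qed.

Lemma measurable_eball_cube x e : measurable (eball x e `&` cube).
Proof. by apply: measurableI; [exact: measurable_eball|exact: measurable_cube]. Qed.

Lemma eball_cube_gt0 x (e : R) : (0 < e)%R -> cube x -> 0 < m (eball x e `&` cube).
Proof.
move=> e0 cx; have [v v0 H] := eball_cube_lower q e0.
by apply: lt_le_trans (H x cx); rewrite lte_fin.
Qed.

Lemma osc_eball_ge0 f x (e : R) : (0 < e)%R -> cube x -> 0 <= osc f (eball x e).
Proof.
by move=> e0 cx; apply: osc_ge0; [exact: measurable_eball_cube|exact: eball_cube_gt0].
Qed.

(** For almost all [y] and [z] in the ball, [|f y|] is at most [|f z|] plus the oscillation.
    Averaging over [z] gives the mean of [|f|] on the ball, at most [normL1 f / v]. *)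
Lemma ae_le_mean_osc f x (e v : R) : (0 < v)%R -> cube x -> inL1 f -> 
  v%:E <= m (eball x e `&` cube) ->
  {ae m, forall y, (eball x e `&` cube) y ->
     `|f y|%:E <= v^-1%:E * normL1 f + osc f (eball x e)}.
Proof.
move=> v0 cx fL1 vB; set B := eball x e.
have mB : measurable (B `&` cube) := measurable_eball_cube x e.
have B0 : 0 < m (B `&` cube) by apply: lt_le_trans vB; rewrite lte_fin.
have O0 : 0 <= osc f B := osc_ge0 f mB B0.
have L0 : 0 <= normL1 f by exact: integral_ge0.
have [->|Ofin] := eqVneq (osc f B) +oo.
  apply: aeW => y _; rewrite addey ?leey// gt_eqF// (@lt_le_trans _ _ 0)//.
  by rewrite mule_ge0// lee_fin invr_ge0 ltW.
have [z0 [_ Iz zS]] := osc_witness f mB B0.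
have [mI mS] : osc_inf f B \is a fin_num /\ osc_sup f B \is a fin_num.
  move: Ofin; rewrite oscE.
  by case: (osc_inf f B) Iz => [a||]; case: (osc_sup f B) zS => [b||].
have SIE : osc f B = (fine (osc_sup f B) - fine (osc_inf f B))%:E.
  by rewrite oscE EFinB !fineK.
set O : R := (fine (osc_sup f B) - fine (osc_inf f B))%R in SIE.
have good : {ae m, forall y, (B `&` cube) y ->
    (fine (osc_inf f B) <= f y <= fine (osc_sup f B))%R}.
  apply: filterS2 (osc_inf_le f B) (osc_sup_ge f B) => y H1 H2 By.
  by rewrite -!lee_fin !fineK// H1// H2.
apply: filterS (good) => y Hy By.
have {}Hy := Hy By.
have Ofy : {ae m, forall z, (B `&` cube) z -> `|f y|%:E <= `|f z|%:E + O%:E}.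
  apply: filterS good => z Hz Bz; have {Hz Bz} := Hz Bz; move: Hy.
  rewrite -EFinD lee_fin /O => /andP[? ?] /andP[? ?].
  have := ler_normD (f y - f z)%R (f z); rewrite subrK.
  have : (`|f y - f z| <= fine (osc_sup f B) - fine (osc_inf f B))%R.
    by rewrite ler_norml; apply/andP; split; lra.
  by move=> ? ?; lra.
have mf : measurable_fun cube f.
  by move/measurable_int : fL1 => /measurable_EFinP.
have mfB : measurable_fun (B `&` cube) f.
  apply: measurable_funS mf; [exact: measurable_cube|exact: subIsetr].
have O0' : (0 <= O)%R by rewrite -lee_fin -SIE.
have : `|f y|%:E * m (B `&` cube) <= normL1 f + O%:E * m (B `&` cube).
  have -> : `|f y|%:E * m (B `&` cube) = \int[m]_(z in B `&` cube) `|f y|%:E.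
    by rewrite integral_cst.
  apply: le_trans (@ae_ge0_le_integral _ _ _ m _ mB _ (fun z => `|f z|%:E + O%:E) _ _ _ _ Ofy) _.
  - by move=> z _; rewrite lee_fin.
  - exact: measurable_cst.
  - by move=> z _; rewrite -EFinD lee_fin addr_ge0.
  - apply: emeasurable_funD; last exact: measurable_cst.
    by apply/measurable_EFinP; apply: measurableT_comp.
  rewrite ge0_integralD//; last first.
    by apply/measurable_EFinP; apply: measurableT_comp.
  rewrite integral_cst// leeD2r// /normL1.
  apply: ge0_subset_integral => //; [exact: measurable_cube|].
  by apply/measurable_EFinP; apply: measurableT_comp.
have mB1 : m (B `&` cube) <= 1.
  rewrite -(@lebn_cube R q); apply: le_measure; rewrite ?inE//; exact: measurable_cube.
have mBfin : m (B `&` cube) \is a fin_num.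
  by rewrite ge0_fin_numE// (le_lt_trans mB1)// ltry.
have Lfin : normL1 f \is a fin_num.
  rewrite ge0_fin_numE//; by move/integrableP : fL1 => [].
move: vB; rewrite SIE -(fineK mBfin) -(fineK Lfin) -!EFinM -!EFinD !lee_fin => vB.
set L := fine (normL1 f); set M := fine (m _) in vB *.
have L0' : (0 <= L)%R by rewrite fine_ge0.
have M0 : (0 < M)%R by apply: lt_le_trans vB.
move=> H.
have H2 : (`|f y| - O <= L / M)%R by rewrite ler_pdivlMr// mulrBl lerBlDr.
have H3 : (L / M <= L / v)%R by rewrite ler_wpM2l// lef_pV2 ?posrE.
rewrite mulrC; lra.
Qed.

End oscillation.

(** * Quasi-Holder functions *)

Section quasi_holder.
Context {R : realType} (q : nat) (eps0 alpha : R).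
Hypotheses (eps0_gt0 : 0 < eps0) (alpha01 : 0 < alpha <= 1).
Local Notation m := (lebn q : {measure set (Rq R q) -> \bar R}).
Local Notation cube := (@cube R q).
Local Notation inV := (@inV R q eps0 alpha).
Local Notation norm_alpha := (@norm_alpha R q eps0 alpha).
Implicit Types (f g : Rq R q -> R) (x y : Rq R q) (e N : R).
Local Open Scope ereal_scope.

(** Fubini on the pairs [(x, y)] of [cube * A] at distance less than [e]: if every [x] saw a null
    part of [A], the set of pairs would be null, whereas each [y] in [A] contributes at least
    [v]. *)
Lemma exists_dense_center (A : set (Rq R q)) e : measurable A -> A `<=` cube ->
  0 < m A -> (0 < e)%R -> exists2 x, cube x & 0 < m (A `&` eball x e).
Proof.
move=> mA Ac A0 e0.
have [v v0 Hv] := eball_cube_lower q e0.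
apply: contrapT => /forall2NP H.
have H0 x : cube x -> m (A `&` eball x e) = 0.
  move=> cx; apply/eqP; rewrite -measure_le0 leNgt; apply/negP.
  by case: (H x).
pose S : set (Rq R q * Rq R q) := (cube `*` A) `&` [set p | eball p.1 e p.2].
have mS : measurable S.
  apply: measurableI; last exact: measurable_eball_graph.
  by apply: measurableX => //; exact: measurable_cube.
have := @indic_fubini_tonelli _ _ _ _ _ (lebn q) (lebn q) _ mS.
rewrite indic_fubini_tonelli_FE// indic_fubini_tonelli_GE//.
rewrite [X in X = _ -> _]integral0_eq; last first.
  move=> x _ /=; have [cx|ncx] := pselect (cube x).
    rewrite -(H0 x cx); congr (m _); apply/seteqP; split => y;
      rewrite /xsection/= inE /S /=; first by move=> [[_ ?] ?].
    by move=> [? ?].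
  rewrite (_ : xsection _ _ = set0) ?measure0//.
  by apply/seteqP; split => // y; rewrite /xsection/= inE => -[[]].
have : v%:E * m A <= \int[m]_y (m \o ysection S) y.
  rewrite -integral_cst// integral_mkcond.
  apply: ge0_le_lower_integral => y _.
    by rewrite patchE; case: ifPn => // _; rewrite lee_fin ltW.
  rewrite patchE; case: ifPn => [/set_mem Ay|_]; last exact: measure_ge0.
  apply: (le_trans (Hv y (Ac _ Ay))); rewrite /=; apply: le_measure; rewrite ?inE.
  - exact: measurable_eball_cube.
  - exact: measurable_ysection.
  - move=> x [Bx cx]; rewrite /ysection/= inE; split => //=.
    exact: eballC.
move=> H1 H2; have : v%:E * m A <= 0 := eq_ind_r (fun z => v%:E * m A <= z) H1 H2.
by rewrite leNgt mule_gt0// lte_fin.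
Qed.

Lemma osc_integral_ge0 f e : (0 < e)%R -> 0 <= \int[m]_(x in cube) osc f (eball x e).
Proof. by move=> e0; apply: integral_ge0 => x cx; exact: osc_eball_ge0. Qed.

Lemma seminorm_ge f e : (0 < e <= eps0)%R ->
  (e `^ (- alpha))%:E * \int[m]_(x in cube) osc f (eball x e) <=
  seminorm_alpha eps0 alpha f.
Proof. by move=> ee; apply: ereal_sup_ubound; exists e. Qed.

Lemma normL1_ge0 f : 0 <= normL1 f.
Proof. exact: integral_ge0. Qed.

Lemma seminorm_ge0 f : 0 <= seminorm_alpha eps0 alpha f.
Proof.
apply: le_trans (@seminorm_ge f eps0 _); last by rewrite eps0_gt0 lexx.
by rewrite mule_ge0// ?lee_fin ?powR_ge0//; exact: osc_integral_ge0.
Qed.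

Lemma norm_alpha_ge0 f : 0 <= norm_alpha f.
Proof. by rewrite adde_ge0 ?normL1_ge0 ?seminorm_ge0. Qed.

Lemma normL1_le_alpha f : normL1 f <= norm_alpha f.
Proof. by rewrite leeDl// seminorm_ge0. Qed.

Lemma osc_integral_le f e N : (0 < e <= eps0)%R -> norm_alpha f <= N%:E ->
  \int[m]_(x in cube) osc f (eball x e) <= (e `^ alpha * N)%:E.
Proof.
move=> /[dup] ee /andP[e0 _] fN.
have := le_trans (seminorm_ge f ee) (le_trans (leeDr _ (normL1_ge0 f)) fN).
by rewrite powRN EFinM lee_pdivrMl// powR_gt0.
Qed.

(* If [f] were large on a non-null set, that set would charge a ball of half
   the size, and [f] would oscillate a lot around every point of that ball. *)
Lemma Valpha_bounded : exists2 C : R, (0 < C)%R &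
  forall f N, (0 < N)%R -> inV f -> norm_alpha f <= N%:E ->
  {ae m, forall x, cube x -> (`|f x| <= C * N)%R}.
Proof.
have [v v0 Hv] := eball_cube_lower q eps0_gt0.
have e1 : (0 < eps0 / (2 * q.+1%:R))%R by rewrite divr_gt0// mulr_gt0.
have [w w0 Hw] := eball_cube_lower q e1.
exists (v^-1 + eps0 `^ alpha / w + 1)%R.
  by rewrite ltr_wpDl// addr_ge0 ?invr_ge0 ?divr_ge0 ?powR_ge0// ltW.
set C : R := (v^-1 + _ + _)%R.
have CE : (C - v^-1 = eps0 `^ alpha / w + 1)%R by rewrite /C; ring.
move=> f N N0 [fL1 fV] fN.
have mf : measurable_fun cube f by move/measurable_int : fL1 => /measurable_EFinP.
pose A : set (Rq R q) := cube `&` [set y | (C * N < `|f y|)%R].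
have mA : measurable A.
  have mnf : measurable_fun cube (fun x => `|f x|)%R by exact: measurableT_comp.
  have := mnf (@measurable_cube R q) `]C * N, +oo[%classic%R (measurable_itv _).
  by congr measurable; apply/seteqP; split => y /= [? h]; split => //; move: h;
    rewrite in_itv/= andbT.
have [A0|] := leP (m A) 0.
  exists A; split => //; first by apply/eqP; rewrite -measure_le0.
  by move=> x /= /not_implyP[cx /negP]; rewrite -ltNge.
move=> A0.
have [x0 cx0 Ax0] := exists_dense_center mA (@subIsetl _ _ _) A0 e1.
have big x : (eball x0 (eps0 / (2 * q.+1%:R)) `&` cube) x ->
    ((C - v^-1) * N)%:E <= osc f (eball x eps0).
  move=> [Bx cx].
  have mAB : measurable (A `&` eball x0 (eps0 / (2 * q.+1%:R))).
    by apply: measurableI => //; exact: measurable_eball.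
  have [y [Ay By] Hy] := ae_nonempty mAB Ax0 (filterS (fun y (H : _ -> _) (Ay :
    (A `&` eball x0 (eps0 / (2 * q.+1%:R))) y) => H (conj (eball_subset eps0_gt0 Bx Ay.2) Ay.1.1))
    (ae_le_mean_osc v0 cx fL1 (Hv x cx))).
  have Ly : (v^-1)%:E * normL1 f <= (v^-1 * N)%:E.
    rewrite EFinM lee_pmul2l ?lte_fin ?invr_gt0//.
    exact: le_trans (normL1_le_alpha f) fN.
  rewrite mulrBl EFinB leeBlDl//; apply: le_trans (leeD Ly (lexx _)).
  by apply: le_trans Hy; rewrite lee_fin; apply: ltW; exact: Ay.2.
have : ((C - v^-1) * N)%:E * w%:E <= \int[m]_(x in cube) osc f (eball x eps0).
  have CN0 : (0 <= (C - v^-1) * N)%R.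
    rewrite mulr_ge0 ?(ltW N0)// CE.
    by rewrite addr_ge0// divr_ge0 ?powR_ge0 ?ltW.
  apply: (@le_trans _ _ (((C - v^-1) * N)%:E * m (eball x0 (eps0 / (2 * q.+1%:R)) `&` cube))).
    by rewrite lee_wpmul2l ?lee_fin//; exact: Hw.
  rewrite -integral_cst; last exact: measurable_eball_cube.
  rewrite setIC integral_mkcondr.
  apply: ge0_le_lower_integral => x cx.
    by rewrite patchE; case: ifPn => // _; rewrite lee_fin.
  rewrite patchE; case: ifPn => [/set_mem Bx|_]; first exact: big.
  exact: osc_eball_ge0.
have e00 : (0 < eps0 <= eps0)%R by rewrite eps0_gt0 lexx.
move=> /le_trans/(_ (osc_integral_le e00 fN)).
rewrite -EFinM lee_fin leNgt => /negP; case.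
by rewrite mulrAC ltr_pM2r// -ltr_pdivrMr// CE ltrDl.
Qed.

Lemma inV_L1 f : inV f -> inL1 f.
Proof. by case. Qed.

(** Brings [f] into the unit ball, over which [opnorm] is a supremum. *)
Lemma inV_scale f N : (0 < N)%R -> inV f -> norm_alpha f <= N%:E ->
  inV (fun x => N^-1 * f x)%R /\ norm_alpha (fun x => N^-1 * f x)%R <= 1.
Proof.
move=> N0 [fL1 fV] fN.
have iN0 : (0 < N^-1)%R by rewrite invr_gt0.
have mf : measurable_fun cube f by move/measurable_int : fL1 => /measurable_EFinP.
have nE : normL1 (fun x => N^-1 * f x)%R = (N^-1)%:E * normL1 f.
  rewrite /normL1 -ge0_integralZl ?lee_fin ?(ltW iN0)//.
  - by apply: eq_integral => x _ /=; rewrite normrM gtr0_norm.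
  - exact: measurable_cube.
  - by apply: measurableT_comp => //; exact/measurable_EFinP.
have sE : seminorm_alpha eps0 alpha (fun x => N^-1 * f x)%R
    <= (N^-1)%:E * seminorm_alpha eps0 alpha f.
  apply: ge_ereal_sup => _ [e /= /[dup] ee /andP[e0 _] <-].
  apply: le_trans (lee_wpmul2l _ (seminorm_ge f ee)); last by rewrite lee_fin ltW.
  rewrite muleCA lee_wpmul2l ?lee_fin ?powR_ge0//.
  apply: le_trans (lower_integralZl_le m (@measurable_cube R q) iN0 _); last first.
    by move=> x cx; exact: osc_eball_ge0.
  apply: ge0_le_lower_integral => x cx; first exact: osc_eball_ge0.
  rewrite oscZ//; [exact: measurable_eball_cube|exact: eball_cube_gt0].
have nn : norm_alpha (fun x => N^-1 * f x)%R <= (N^-1)%:E * norm_alpha f.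
  rewrite /norm_alpha ge0_muleDr ?normL1_ge0 ?seminorm_ge0// nE.
  exact: leeD.
have nn1 : norm_alpha (fun x => N^-1 * f x)%R <= 1.
  by apply: le_trans nn _; rewrite lee_pdivrMl// mule1.
split; last exact: nn1.
split.
  by have := integrableZl (@measurable_cube R q) N^-1 fL1.
apply: le_lt_trans (ltry 1); apply: le_trans nn1.
by rewrite leeDr// normL1_ge0.
Qed.

(* [chi false r] is the indicator of [psi x < r], [chi true r] that of its
   complement. *)
Definition chi (sg : bool) (r : R) x : R := (sg (+) (psi x < r)%R)%:R.

Lemma chi01 sg r x : chi sg r x = 0%R \/ chi sg r x = 1%R.
Proof. by rewrite /chi; case: (_ (+) _); [right|left]. Qed.

Lemma measurable_chi sg r : measurable_fun setT (chi sg r).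
Proof.
pose A : set (Rq R q) := [set x | sg (+) (psi x < r)%R].
have mr : measurable [set x : Rq R q | (psi x < r)%R].
  by apply: measurable_sublevel; exact: measurable_psi.
have mA : measurable A.
  case: (sg) @A => A; last exact: mr.
  have := measurableC mr; congr measurable.
  by apply/seteqP; split => x /= /negP.
have -> : chi sg r = \1_A.
  apply/funext => x; rewrite /chi indicE; congr (nat_of_bool _)%:R.
  by apply/idP/idP => [?|/set_mem//]; rewrite inE.
exact: measurable_indic.
Qed.

(** Within the ball [psi] varies by at most [2 * e < 3 * e], so it cannot cross the level [r]. *)
Lemma chi_eball_cst sg r x y e : (0 < e)%R -> eball x e y -> (3 * e <= `|psi x - r|)%R ->
  chi sg r y = chi sg r x.
Proof.
move=> e0 xy; have := psi_lip xy; have := psi_lip (eballC xy).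
rewrite /chi => H1 H2 H.
suff -> : (psi y < r)%R = (psi x < r)%R by [].
move: H; case: ger0P => [?|?] ?.
  by apply/idP/idP; lra.
by apply/idP/idP; lra.
Qed.

(* A ball of radius [e] meets both [psi < r] and its complement only if its
   centre lies in the tube [`|psi - r| < 3 * e]. *)
Lemma osc_chi_le sg r f x e M : (0 < e)%R -> cube x -> (0 <= M)%R ->
  {ae m, forall y, cube y -> (`|f y| <= M)%R} ->
  osc (fun y => chi sg r y * f y)%R (eball x e) <=
  osc f (eball x e) +
    (2 * M * \1_(cube `&` [set x | (`|psi x - r| < 3 * e)%R]) x)%:E.
Proof.
move=> e0 cx M0 fM; have O0 := osc_eball_ge0 f e0 cx.
rewrite indicE; have [xr|rx] := ltP `|psi x - r|%R (3 * e)%R.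
  rewrite mem_set// mulr1; apply: (@le_trans _ _ (2 * M)%:E); last by rewrite leeDr.
  have -> : (2 * M = M - (- M))%R by ring.
  apply: osc_le; apply: filterS fM => y Hy [_ cy]; have {Hy} := Hy cy.
  rewrite -ler_norml normrM => /(le_trans _); apply.
  by rewrite ler_piMl//; case: (chi01 sg r y) => ->; rewrite ?normr0 ?normr1.
rewrite memNset ?mulr0 ?adde0; last by move=> [_ /=]; rewrite ltNge rx.
have chiE y : (eball x e `&` cube) y -> chi sg r y = chi sg r x.
  by move=> [By _]; exact: (chi_eball_cst sg e0 By rx).
case: (chi01 sg r x) => x01.
  apply: (le_trans _ O0); have -> : 0 = (0 - 0)%R%:E :> \bar R by rewrite subrr.
  apply: osc_le; apply: aeW => y By.
  by rewrite chiE// x01 mul0r lexx.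
by rewrite (@eq_osc _ _ _ f)// => y By; rewrite chiE// x01 mul1r.
Qed.

Lemma chi_mul_bounded : (2 <= q)%N -> exists2 K : R, (0 < K)%R &
  forall sg r f N, (0 < N)%R -> inV f -> norm_alpha f <= N%:E ->
  inV (fun y => chi sg r y * f y)%R /\
  norm_alpha (fun y => chi sg r y * f y)%R <= (K * N)%:E.
Proof.
move=> q2; have [C C0 HC] := Valpha_bounded.
pose K := (2 * C * (q%:R * (4 * 3)) * eps0 `^ (1 - alpha))%R.
have K0 : (0 <= K)%R.
  by rewrite !mulr_ge0 ?powR_ge0 ?(ltW C0)//.
exists (1 + K)%R; first by rewrite ltr_pwDl.
move=> sg r f N N0 fV fN; have [fL1 _] := fV.
have mf : measurable_fun cube f by move/measurable_int : fL1 => /measurable_EFinP.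
have mcf : measurable_fun cube (fun y => chi sg r y * f y)%R.
  by apply: measurable_funM => //; apply: measurable_funTS; exact: measurable_chi.
have cf y : (`|chi sg r y * f y| <= `|f y|)%R.
  rewrite normrM ler_piMl//.
  by case: (chi01 sg r y) => ->; rewrite ?normr0 ?normr1.
have cfL1 : inL1 (fun y => chi sg r y * f y)%R.
  apply: le_integrable fL1; first exact: measurable_cube.
    exact/measurable_EFinP.
  by move=> y _ /=; rewrite lee_fin.
have nL1 : normL1 (fun y => chi sg r y * f y)%R <= normL1 f.
  by apply: ge0_le_lower_integral => y _ //; rewrite /= lee_fin.
have fM := HC f N N0 fV fN.
have M0 : (0 <= C * N)%R by rewrite mulr_ge0 ?ltW.
have sle : seminorm_alpha eps0 alpha (fun y => chi sg r y * f y)%R <=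
    seminorm_alpha eps0 alpha f + (K * N)%:E.
  apply: ge_ereal_sup => _ [e /= /[dup] ee /andP[e0 ee0] <-].
  set Z := cube `&` [set x | (`|psi x - r| < 3 * e)%R].
  have mZ : measurable Z := measurable_psi_annulus r (3 * e).
  have iZ : \int[m]_(x in cube) (2 * (C * N) * \1_Z x)%:E <=
      (2 * (C * N) * (q%:R * (4 * (3 * e))))%:E.
    under eq_integral do rewrite EFinM.
    rewrite ge0_integralZl//; last 3 first.
    - exact: measurable_cube.
    - by apply/measurable_EFinP; exact: measurable_indic.
    - by rewrite lee_fin mulr_ge0.
    rewrite integral_indic//; last exact: measurable_cube.
    rewrite [leRHS]EFinM lee_wpmul2l ?lee_fin ?mulr_ge0 ?(ltW C0) ?(ltW N0)//.
    rewrite setIAC setIid; apply: lebn_psi_annulus_le => //.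
    by rewrite mulr_gt0.
  have int_le : \int[m]_(x in cube) osc (fun y => chi sg r y * f y)%R (eball x e) <=
      \int[m]_(x in cube) osc f (eball x e) +
      (2 * (C * N) * (q%:R * (4 * (3 * e))))%:E.
    apply: (@le_trans _ _ (\int[m]_(x in cube) (osc f (eball x e) +
        (2 * (C * N) * \1_Z x)%:E))).
      apply: ge0_le_lower_integral => x cx; first exact: osc_eball_ge0.
      exact: osc_chi_le.
    apply: (le_trans (lower_integralD_le _ _ _ _ _)) => //.
    - exact: measurable_cube.
    - by move=> x cx; exact: osc_eball_ge0.
    - by move=> x _; rewrite indicE; apply: mulr_ge0 => //; exact: mulr_ge0.
    - apply: measurable_funM; first exact: measurable_cst.
      exact: measurable_indic.
    - exact: leeD.
  apply: le_trans (lee_wpmul2l _ int_le) _; first by rewrite lee_fin powR_ge0.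
  rewrite ge0_muleDr; last 2 first.
    exact: osc_integral_ge0.
  - by rewrite lee_fin !mulr_ge0// ltW.
  apply: leeD; first exact: seminorm_ge.
  rewrite -EFinM lee_fin.
  have -> : (e `^ (- alpha) * (2 * (C * N) * (q%:R * (4 * (3 * e)))) =
     2 * C * (q%:R * (4 * 3)) * (e `^ (- alpha) * e) * N)%R by ring.
  have -> : (e `^ (- alpha) * e = e `^ (1 - alpha))%R.
    rewrite addrC powRD; last by rewrite (gt_eqF e0) implybT.
    by rewrite powRr1// ltW.
  rewrite /K ler_wpM2r ?(ltW N0)// ler_wpM2l ?mulr_ge0 ?(ltW C0)//.
  apply: ge0_ler_powR; rewrite ?nnegrE ?(ltW e0) ?(ltW eps0_gt0)//.
  by rewrite subr_ge0; case/andP: alpha01.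
have nle : norm_alpha (fun y => chi sg r y * f y)%R <= ((1 + K) * N)%:E.
  rewrite mulrDl mul1r EFinD; apply: le_trans (leeD fN (lexx _)).
  by rewrite /Defs.norm_alpha -[leRHS]addeA; exact: (leeD nL1 sle).
split; last exact: nle.
split; first exact: cfL1.
apply: le_lt_trans (ltry ((1 + K) * N)); apply: le_trans nle.
by rewrite leeDr// normL1_ge0.
Qed.

End quasi_holder.

(** * Decay of correlations *)

Section cube_integral.
Context {R : realType} (q : nat).
Local Notation m := (lebn q : {measure set (Rq R q) -> \bar R}).
Local Notation cube := (@cube R q).
Local Notation I := (@integral_cube R q).
Implicit Types (f g u v : Rq R q -> R).

(** The class of test functions. The bounds hold at every point of the cube, which composition with
    [F] preserves. *)
Definition unit_fun g := measurable_fun cube g /\ forall x, cube x -> 0 <= g x <= 1.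

Lemma unit_fun_inLoo g : unit_fun g -> inLoo g.
Proof.
move=> [mg g01]; split => //; exists 1; apply: aeW => x cx.
by have /andP[g0 g1] := g01 x cx; rewrite ger0_norm.
Qed.

Lemma unit_funM f g : unit_fun f -> unit_fun g -> unit_fun (fun x => f x * g x).
Proof.
move=> [mf f01] [mg g01]; split; first exact: measurable_funM.
move=> x cx; have /andP[f0 f1] := f01 x cx; have /andP[g0 g1] := g01 x cx.
by rewrite mulr_ge0// mulr_ile1.
Qed.

Lemma inL1_measurable f : inL1 f -> measurable_fun cube f.
Proof. by move/measurable_int => /measurable_EFinP. Qed.

Lemma inL1M f g : inL1 f -> unit_fun g -> inL1 (fun x => f x * g x).
Proof.
move=> fL1 [mg g01]; have mf := inL1_measurable fL1; apply: le_integrable fL1; first exact: measurable_cube.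
  by apply/measurable_EFinP; apply: measurable_funM.
move=> x cx /=; rewrite lee_fin normrM ler_piMr//.
by have /andP[g0 g1] := g01 x cx; rewrite ger0_norm.
Qed.

Lemma inL1_unit g : unit_fun g -> inL1 g.
Proof.
move=> [mg g01]; apply: measurable_bounded_integrable => //.
- exact: measurable_cube.
- apply: le_lt_trans (ltry 1); rewrite le_eqVlt; apply/orP; left.
  apply/eqP; exact: lebn_cube.
- exists 1; split => // M M1 x cx; have /andP[g0 g1] := g01 x cx.
  by rewrite /mkset ger0_norm// (le_trans g1)// ltW.
Qed.

Lemma inL1D f g : inL1 f -> inL1 g -> inL1 (fun x => f x + g x).
Proof. by move=> f1 g1; have := integrableD (@measurable_cube R q) f1 g1. Qed.

Lemma inL1Z (k : R) f : inL1 f -> inL1 (fun x => k * f x).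
Proof. by move=> f1; have := integrableZl (@measurable_cube R q) k f1. Qed.

Lemma integral_cubeD f g : inL1 f -> inL1 g -> I (fun x => f x + g x) = I f + I g.
Proof. by move=> f1 g1; apply: RintegralD => //; exact: measurable_cube. Qed.

Lemma integral_cubeZ (k : R) f : inL1 f -> I (fun x => k * f x) = k * I f.
Proof. by move=> f1; apply: RintegralZl => //; exact: measurable_cube. Qed.

Lemma integral_cubeB f g : inL1 f -> inL1 g -> I (fun x => f x - g x) = I f - I g.
Proof. by move=> f1 g1; apply: RintegralB => //; exact: measurable_cube. Qed.

Lemma eq_integral_cube f g : (forall x, cube x -> f x = g x) -> I f = I g.
Proof. by move=> fg; apply: eq_Rintegral => x /set_mem; exact: fg. Qed.

Lemma ae_eq_integral_cube f g : inL1 f -> inL1 g -> ae_eq_cube f g -> I f = I g.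
Proof.
move=> f1 g1 fg; congr fine; apply: ae_eq_integral.
- exact: measurable_cube.
- exact: measurable_int f1.
- exact: measurable_int g1.
- by apply: filterS fg => x H cx; rewrite /= H.
Qed.

Lemma ae_le_integral_cube f g : inL1 f -> inL1 g ->
  {ae m, forall x, cube x -> f x <= g x} -> I f <= I g.
Proof.
move=> f1 g1 fg; rewrite -subr_ge0 -integral_cubeB//.
have gf1 : inL1 (fun x => g x - f x).
  by have := integrableB (@measurable_cube R q) g1 f1.
rewrite (@ae_eq_integral_cube _ (fun x => `|g x - f x|))//.
- exact: Rintegral_ge0.
- exact: (integrable_norm gf1).
- by apply: filterS fg => x H cx; rewrite ger0_norm// subr_ge0 H.
Qed.

End cube_integral.

Section quasi_compact.
Context {R : realType} (q : nat) (F : Rq R q -> Rq R q).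
Variables (P Q : (Rq R q -> R) -> Rq R q -> R) (h : Rq R q -> R).
Variables (eps0 alpha : R).
Local Notation m := (lebn q : {measure set (Rq R q) -> \bar R}).
Local Notation cube := (@cube R q).
Local Notation I := (@integral_cube R q).
Local Notation inV := (@inV R q eps0 alpha).
Local Notation norm_alpha := (@norm_alpha R q eps0 alpha).
Implicit Types (f g : Rq R q -> R) (n : nat).
Hypotheses (eps0_gt0 : 0 < eps0) (alpha01 : 0 < alpha <= 1).
Hypotheses (mF : measurable_fun cube F) (Fcube : forall x, cube x -> cube (F x)).
Hypothesis P_transfer : transfer_operator F P.
Hypotheses (hV : inV h) (h1 : I h = 1).
Hypothesis QV : forall f, inV f -> inV (Q f).
Hypothesis PQ : forall f, inV f -> ae_eq_cube (P f) (fun x => I f * h x + Q f x).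
Hypothesis Q0 : forall f, inV f -> I (Q f) = 0.
Hypothesis Qh : ae_eq_cube (Q h) (fun=> 0).
Hypothesis Qr : (spectral_radius eps0 alpha Q < 1)%E.

(* Unfolding these makes failed unifications of functions diverge. *)
Local Opaque Defs.inV Defs.norm_alpha.

Lemma iter_cube n x : cube x -> cube (iter n F x).
Proof. by move=> cx; elim: n => //= n ih; exact: Fcube. Qed.

Lemma unit_fun_comp g : unit_fun g -> unit_fun (g \o F).
Proof.
move=> [mg g01]; split; last by move=> x cx; exact/g01/Fcube.
apply: (measurable_comp (F := cube)) => //; first exact: measurable_cube.
by move=> _ [x cx <-]; exact: Fcube.
Qed.

Lemma unit_fun_iter n g : unit_fun g -> unit_fun (g \o iter n F).
Proof.
elim: n g => [//|n ih] g ug; have := ih _ (unit_fun_comp ug).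
by congr unit_fun; apply/funext => x; rewrite /= .
Qed.

Lemma iter_inV n f : inV f -> inV (iter n Q f).
Proof. move=> fV; elim: n => [|n ih]; [exact: fV|exact: QV ih]. Qed.

Lemma transferE f g : inL1 f -> unit_fun g ->
  I (fun x => P f x * g x) = I (fun x => f x * g (F x)).
Proof. by move=> /P_transfer[_ H] /unit_fun_inLoo /H. Qed.

(** [P h = h] almost everywhere, since [I h = 1] and [Q h] vanishes; duality turns this into
    invariance of the measure. *)
Lemma density_invariant g : unit_fun g ->
  I (fun x => h x * g (F x)) = I (fun x => h x * g x).
Proof.
move=> ug; have hL1 := inV_L1 hV; rewrite -transferE//.
have [PhL1 _] := P_transfer hL1.
apply: ae_eq_integral_cube; [exact: inL1M|exact: inL1M|].
apply: filterS2 (PQ hV) Qh => x H1 H2 cx.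
by rewrite H1// H2// h1 mul1r addr0.
Qed.

Lemma Q_weak f g : inV f -> unit_fun g ->
  I (fun x => Q f x * g x) = I (fun x => f x * g (F x)) - I f * I (fun x => h x * g x).
Proof.
move=> fV ug; have fL1 := inV_L1 fV; have hL1 := inV_L1 hV; have QfL1 := inV_L1 (QV fV).
have [PfL1 _] := P_transfer fL1.
rewrite -transferE// -integral_cubeZ; last exact: inL1M.
rewrite -integral_cubeB; [|exact: inL1M|exact/inL1Z/inL1M].
apply: ae_eq_integral_cube; first exact: inL1M.
  have := integrableB (@measurable_cube R q) (inL1M PfL1 ug) (inL1Z (I f) (inL1M hL1 ug)).
  by [].
by apply: filterS (PQ fV) => x H cx; rewrite H//; ring.
Qed.

(** Each step of the induction moves one [F] onto the test function. The rank-one term vanishes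
    because the images of [Q] have integral 0, and invariance of [h] removes the extra [F] from the
    product of means. The exponent starts at 1: the zeroth iterate has not yet lost its component
    along [h]. *)
Lemma Qiter_weak n f g : inV f -> unit_fun g ->
  I (fun x => iter n.+1 Q f x * g x) =
  I (fun x => f x * g (iter n.+1 F x)) - I f * I (fun x => h x * g x).
Proof.
move=> fV; elim: n g => [|n ih] g ug; first exact: Q_weak.
apply: (etrans (Q_weak (iter_inV n.+1 fV) ug)).
have I0 : I (iter n.+1 Q f) = 0 := Q0 (iter_inV n fV).
rewrite I0 mul0r subr0; apply: (etrans (ih (g \o F) (unit_fun_comp ug))).
by rewrite -(density_invariant ug).
Qed.

Lemma spectral_decay : exists2 rho : R, 0 < rho < 1 &
  exists2 N0, (0 < N0)%N & forall n f, (N0 <= n)%N -> inV f -> (norm_alpha f <= 1)%E ->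
    (norm_alpha (iter n Q f) <= (rho ^+ n)%:E)%E.
Proof.
move: Qr; rewrite /spectral_radius /limn_esup limf_esupE => /ereal_inf_lt[_ [V [N _ NV] <-]].
set sV := ereal_sup _ => sV1.
(* The maximum with [1 / 2] keeps [rho] positive even when the tail supremum is 0. *)
have [rho rho01 Vrho] : exists2 rho : R, 0 < rho < 1 & (sV <= rho%:E)%E.
  case: sV sV1 => [r||] // r1; last by exists (1 / 2); [lra|exact: leNye].
  exists (Num.max r (1 / 2)); last by rewrite lee_fin le_max lexx.
  have [half0 half1] : (0 : R) < 1 / 2 /\ (1 / 2 : R) < 1 by split; lra.
  by move: r1; rewrite lte_fin lt_max gt_max half0 half1 orbT => ->.
(* [N.+1] forces [n] to be nonzero, so that raising to the power [n] undoes the root. *)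
exists rho => //; exists N.+1 => // n f Nn fV f1.
have n0 : n%:R != 0 :> R by rewrite pnatr_eq0 -lt0n (leq_ltn_trans _ Nn).
set y := norm_alpha _.
have y0 : (0 <= y)%E by exact: norm_alpha_ge0.
have yop : (y <= opnorm eps0 alpha (iter n Q))%E.
  by apply: ereal_sup_ubound; exists f.
have : (poweR y n%:R^-1 <= rho%:E)%E.
  apply: le_trans Vrho; apply: (@le_trans _ _ (poweR (opnorm eps0 alpha (iter n Q)) n%:R^-1)).
    apply: gt0_ler_poweR => //; first by rewrite in_itv/= y0 leey.
    by rewrite in_itv/= leey (le_trans y0).
  by apply: ereal_sup_ubound; exists n => //; apply: NV; exact: ltnW.
move=> H; have /andP[rho0 _] := rho01.
have : (poweR (poweR y n%:R^-1) n%:R <= poweR rho%:E n%:R)%E.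
  apply: gt0_ler_poweR => //; rewrite in_itv/= leey ?poweR_ge0//.
  by rewrite lee_fin ltW.
by rewrite -poweRrM mulVf// poweRe1// poweR_EFin powR_mulrn// ltW.
Qed.

(** The embedding into L^oo bounds the iterate of [Q] uniformly, so only the L^1 norm of [g] is
    spent. This factor [I g] is what makes the estimate useful for small targets. *)
Lemma decay_of_correlations : exists C rho (N0 : nat), [/\ 0 < C, 0 < rho < 1 &
  forall f g N n, 0 < N -> inV f -> (norm_alpha f <= N%:E)%E -> unit_fun g ->
   (N0 <= n)%N ->
   `|I (fun x => f x * g (iter n F x)) - I f * I (fun x => h x * g x)|
     <= N * C * rho ^+ n * I g].
Proof.
have [C C0 HC] := @Valpha_bounded R q eps0 alpha eps0_gt0.
have [rho rho01 [N0 N00 HN]] := spectral_decay.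
exists C, rho, N0; split => // f g N n N_gt0 fV fN ug Nn.
(* The iterates of [Q] are estimated on the unit ball only; the factor [N] is restored in the
   correlation itself, which is linear in [f]. *)
have [fV' fN'] := inV_scale eps0_gt0 N_gt0 fV fN.
set f' := (fun x => N^-1 * f x) in fV' fN'.
have fL1 := inV_L1 fV.
have /andP[rho0 _] := rho01.
have nE : n = n.-1.+1 by rewrite prednK// (leq_trans _ Nn).
have uV := iter_inV n fV'; have uL1 := inV_L1 uV.
have rn0 : 0 < rho ^+ n by rewrite exprn_gt0.
have bnd := HC _ _ rn0 uV (HN n f' Nn fV' fN').
have gL1 := inL1_unit ug.
have : `|I (fun x => iter n Q f' x * g x)| <= C * rho ^+ n * I g.
  rewrite ler_norml -integral_cubeZ//; apply/andP; split.
    rewrite -mulN1r -integral_cubeZ; last exact: inL1Z.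
    apply: ae_le_integral_cube; [exact/inL1Z/inL1Z|exact: inL1M|].
    apply: filterS bnd => x H cx; have {H} := H cx; rewrite ler_norml => /andP[H _].
    by rewrite mulN1r -mulNr ler_wpM2r//; have [_ /(_ x cx)/andP[]] := ug.
  apply: ae_le_integral_cube; [exact: inL1M|exact/inL1Z|].
  apply: filterS bnd => x H cx; have {H} := H cx; rewrite ler_norml => /andP[_ H].
  by rewrite ler_wpM2r//; have [_ /(_ x cx)/andP[]] := ug.
rewrite [in X in X -> _]nE Qiter_weak// -nE.
have -> : I f' = N^-1 * I f by rewrite integral_cubeZ.
have -> : I (fun x => f' x * g (iter n F x)) = N^-1 * I (fun x => f x * g (iter n F x)).
  rewrite -integral_cubeZ; last exact: (inL1M fL1 (unit_fun_iter n ug)).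
  by apply: eq_integral_cube => x _; rewrite /f' mulrA.
set A := I (fun x => f x * g (iter n F x)); set D := I (fun x => h x * g x).
have -> : N^-1 * A - N^-1 * I f * D = N^-1 * (A - I f * D) by ring.
rewrite normrM gtr0_norm ?invr_gt0// ler_pdivrMl//.
by rewrite !mulrA.
Qed.

End quasi_compact.

(** * Returns to the target *)

Section return_times.
Context {R : realType} (q : nat) (F : Rq R q -> Rq R q).
Variables (P : (Rq R q -> R) -> Rq R q -> R) (h : Rq R q -> R).
Variables (eps0 alpha C rho c0 K M Nh : R) (N0 : nat).
Local Notation m := (lebn q : {measure set (Rq R q) -> \bar R}).
Local Notation cube := (@cube R q).
Local Notation I := (@integral_cube R q).
Local Notation inV := (@inV R q eps0 alpha).
Local Notation norm_alpha := (@norm_alpha R q eps0 alpha).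
Implicit Types (f g : Rq R q -> R) (n k t j : nat) (r : R).
Hypotheses (mF : measurable_fun cube F) (Fcube : forall x, cube x -> cube (F x)).
Hypothesis P_transfer : transfer_operator F P.
Hypotheses (hV : inV h) (h1 : I h = 1).
Hypothesis h_inv : forall g, unit_fun g ->
  I (fun x => h x * g (F x)) = I (fun x => h x * g x).
Hypotheses (C_gt0 : 0 < C) (rho01 : 0 < rho < 1).
Hypothesis decay : forall f g N n, 0 < N -> inV f -> (norm_alpha f <= N%:E)%E ->
  unit_fun g -> (N0 <= n)%N ->
  `|I (fun x => f x * g (iter n F x)) - I f * I (fun x => h x * g x)|
     <= N * C * rho ^+ n * I g.
Hypotheses (c0_gt0 : 0 < c0) (h_ge : {ae m, forall x, cube x -> c0 <= h x}).
Hypotheses (K_gt0 : 0 < K) (M_gt0 : 0 < M) (Nh_gt0 : 0 < Nh).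
Hypothesis chiK : forall sg r f N, 0 < N -> inV f -> (norm_alpha f <= N%:E)%E ->
  inV (fun y => chi sg r y * f y) /\
  (norm_alpha (fun y => (chi sg r y * f y)%R) <= (K * N)%:E)%E.
Hypothesis PM : forall f N, 0 < N -> inV f -> (norm_alpha f <= N%:E)%E ->
  inV (P f) /\ (norm_alpha (P f) <= (M * N)%:E)%E.
Hypothesis hNh : (norm_alpha h <= Nh%:E)%E.

(* Unfolding these makes failed unifications of functions diverge. *)
Local Opaque Defs.inV Defs.norm_alpha.

Lemma unit_chi sg r : unit_fun (@chi R q sg r).
Proof.
split; first by apply: measurable_funTS; exact: measurable_chi.
by move=> x _; case: (chi01 sg r x) => ->; rewrite ?lexx ?ler01.
Qed.

Lemma chi_trueE r (x : Rq R q) : chi true r x = 1 - chi false r x.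
Proof. by rewrite /chi /=; case: (_ < _); rewrite ?subrr ?subr0. Qed.

(* The orbit of [x] stays out of [psi < r] at times [0, ..., n - 1]. *)
Definition avoid r n (x : Rq R q) : R := \prod_(j < n) chi true r (iter j F x).

Lemma avoid0 r x : avoid r 0 x = 1.
Proof. by rewrite /avoid big_ord0. Qed.

Lemma avoidS r n x : avoid r n.+1 x = chi true r x * avoid r n (F x).
Proof.
rewrite /avoid big_ord_recl/=; congr (_ * _).
by apply: eq_bigr => i _; rewrite /= -iterSr.
Qed.

Lemma avoidD r k n x : avoid r (k + n) x = avoid r k x * avoid r n (iter k F x).
Proof.
elim: k x => [|k ih] x; first by rewrite add0n avoid0 mul1r.
by rewrite addSn !avoidS ih mulrA -iterSr.
Qed.

Lemma avoid_recr r k x : avoid r k.+1 x = avoid r k x * chi true r (iter k F x).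
Proof. by rewrite /avoid big_ord_recr. Qed.

Lemma unit_avoid r n : unit_fun (avoid r n).
Proof.
elim: n => [|n ih].
  split; last by move=> x _; rewrite avoid0 ler01 lexx.
  by rewrite (_ : avoid r 0 = cst 1) //; apply/funext => x; rewrite avoid0.
rewrite (_ : avoid r n.+1 = fun x => chi true r x * (avoid r n \o F) x).
  by apply: unit_funM; [exact: unit_chi|exact: (unit_fun_comp mF Fcube ih)].
by apply/funext => x; rewrite avoidS.
Qed.

Definition mu g : R := I (fun x => h x * g x).

Let hL1 : inL1 h := inV_L1 hV.

Lemma mu_inL1 g : unit_fun g -> inL1 (fun x => h x * g x).
Proof. by move=> ug; exact: inL1M. Qed.

Lemma mu_eq f g : (forall x, cube x -> f x = g x) -> mu f = mu g.
Proof. by move=> fg; apply: eq_integral_cube => x cx; rewrite fg. Qed.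

Lemma mu_le f g : unit_fun f -> unit_fun g -> (forall x, cube x -> f x <= g x) ->
  mu f <= mu g.
Proof.
move=> uf ug fg; apply: ae_le_integral_cube; [exact: mu_inL1|exact: mu_inL1|].
apply: filterS h_ge => x H cx; rewrite ler_wpM2l ?fg//.
exact: le_trans (ltW c0_gt0) (H cx).
Qed.

Lemma mu_leD f g g' : unit_fun f -> unit_fun g -> unit_fun g' ->
  (forall x, cube x -> f x <= g x + g' x) -> mu f <= mu g + mu g'.
Proof.
move=> uf ug ug' fg.
rewrite /mu -integral_cubeD; [|exact: mu_inL1|exact: mu_inL1].
apply: ae_le_integral_cube; first exact: mu_inL1.
  by apply: inL1D; exact: mu_inL1.
apply: filterS h_ge => x H cx; rewrite -mulrDr ler_wpM2l ?fg//.
exact: le_trans (ltW c0_gt0) (H cx).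
Qed.

Lemma mu_ge0 g : unit_fun g -> 0 <= mu g.
Proof.
move=> ug; have hg0 : I (fun x => 0 * (h x * g x)) = 0.
  by rewrite integral_cubeZ ?mul0r//; exact: mu_inL1.
rewrite -hg0; apply: ae_le_integral_cube; [exact/inL1Z/mu_inL1|exact: mu_inL1|].
apply: filterS h_ge => x H cx; rewrite mul0r mulr_ge0//.
  exact: le_trans (ltW c0_gt0) (H cx).
by have [_ /(_ x cx)/andP[]] := ug.
Qed.

Lemma unit_iter n g : unit_fun g -> unit_fun (fun x => g (iter n F x)).
Proof. exact: (unit_fun_iter mF Fcube). Qed.

Definition hit r := mu (chi false r).
Definition survival r n := mu (avoid r n).
(* The mass of the points of the target that do not return up to time [n]. *)
Definition escape r n := mu (fun x => chi false r x * avoid r n (F x)).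

Lemma unit_escape r n : unit_fun (fun x => chi false r x * avoid r n (F x)).
Proof.
apply: unit_funM; first exact: unit_chi.
exact: (unit_fun_comp mF Fcube (unit_avoid r n)).
Qed.

Lemma survival0 r : survival r 0 = 1.
Proof.
rewrite -h1 /survival /mu; apply: eq_integral_cube => x _.
by rewrite avoid0 mulr1.
Qed.

Lemma survivalS r n : survival r n.+1 = survival r n - escape r n.
Proof.
have uF := unit_fun_comp mF Fcube (unit_avoid r n).
rewrite /survival /escape /mu -(h_inv (unit_avoid r n)) -integral_cubeB.
- by apply: eq_integral_cube => x _; rewrite avoidS chi_trueE; ring.
- exact: (mu_inL1 uF).
- exact: mu_inL1 (unit_escape r n).
Qed.

Lemma survival_ge0 r n : 0 <= survival r n.
Proof. exact: mu_ge0 (unit_avoid r n). Qed.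

Lemma escape_bounds r n : 0 <= escape r n <= hit r.
Proof.
rewrite mu_ge0/=; last exact: unit_escape.
apply: mu_le; [exact: unit_escape|exact: unit_chi|] => x cx.
have [_ /(_ (F x) (Fcube cx))/andP[_ a1]] := unit_avoid r n.
by have [_ /(_ x cx)/andP[b0 _]] := unit_chi false r; rewrite ler_piMr.
Qed.

Lemma survival_decr r n k : 0 <= survival r n - survival r (n + k) <= k%:R * hit r.
Proof.
elim: k => [|k /andP[ih1 ih2]]; first by rewrite addn0 subrr mul0r lexx.
have /andP[a0 ad] := escape_bounds r (n + k).
by rewrite addnS survivalS -natr1 mulrDl mul1r; apply/andP; split; lra.
Qed.

(** Decay applied to [chi false r * h] and [chi false r]; the lower bound [c0] on [h] turns the
    Lebesgue measure of the target into at most [hit r / c0]. *)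
Lemma correlation_le r j : (N0 <= j)%N ->
  mu (fun x => chi false r x * chi false r (iter j F x))
  <= hit r * (hit r + K * Nh * C / c0 * rho ^+ j).
Proof.
move=> Nj; have [bV bN] := chiK false r Nh_gt0 hV hNh.
have KN : 0 < K * Nh by rewrite mulr_gt0.
have := decay KN bV bN (unit_chi false r) Nj.
set A := I _; set D := I (fun x => chi _ _ _ * _); set B := I (fun x => h x * _).
have -> : A = mu (fun x => chi false r x * chi false r (iter j F x)).
  by apply: eq_integral_cube => x _; ring.
have -> : D = hit r by apply: eq_integral_cube => x _; ring.
rewrite -[B]/(hit r) => H.
have Ib : I (chi false r) <= hit r / c0.
  rewrite ler_pdivlMr// mulrC -integral_cubeZ; last exact: inL1_unit (unit_chi _ _).
  apply: ae_le_integral_cube; first exact/inL1Z/inL1_unit/unit_chi.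
    exact: mu_inL1 (unit_chi _ _).
  by apply: filterS h_ge => x Hx cx; rewrite ler_wpM2r ?Hx.
have /andP[rho0 _] := rho01.
have : K * Nh * C * rho ^+ j * I (chi false r) <= K * Nh * C * rho ^+ j * (hit r / c0).
  by rewrite ler_wpM2l// !mulr_ge0 ?exprn_ge0 ?ltW.
have -> : K * Nh * C * rho ^+ j * (hit r / c0) = hit r * (K * Nh * C / c0 * rho ^+ j).
  by ring.
move=> H2; have := ler_norm (mu (fun x => chi false r x * chi false r (iter j F x)) - hit r * hit r).
by rewrite mulrDr; lra.
Qed.

(* The orbit avoids the target at times [1..k] and, after a gap of length [t],
   from time [t + k + 1] on. *)
Definition gap_escape r n k t := mu (fun x => chi false r x * avoid r k (F x)
  * avoid r (n - (k + t)) (iter (t + k.+1) F x)).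

Lemma unit_gap_escape r n k t : unit_fun (fun x => chi false r x * avoid r k (F x)
  * avoid r (n - (k + t)) (iter (t + k.+1) F x)).
Proof.
by apply: unit_funM; [exact: unit_escape|exact: unit_iter (unit_avoid _ _)].
Qed.

Lemma gap_escape0 r n k : (k <= n)%N -> gap_escape r n k 0 = escape r n.
Proof.
move=> kn; apply: mu_eq => x _; rewrite addn0 add0n.
by rewrite -{2}(subnKC kn) avoidD -iterSr mulrA.
Qed.

(** Widening the gap drops the condition at time [t + k.+1]; the points gained are in the target
    both now and at that time. *)
Lemma gap_escapeS r n k t : (k + t < n)%N ->
  gap_escape r n k t <= gap_escape r n k t.+1 <= gap_escape r n k t
    + mu (fun x => chi false r x * chi false r (iter (t + k.+1) F x)).
Proof.
move=> ktn.
have nE : (n - (k + t) = (n - (k + t.+1)).+1)%N by rewrite addnS subnSK.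
have pw x : cube x ->
  [/\ 0 <= chi false r x * avoid r k (F x) <= chi false r x,
     0 <= chi false r (iter (t + k.+1) F x) <= 1 &
     0 <= avoid r (n - (k + t.+1)) (F (iter (t + k.+1) F x)) <= 1].
  move=> cx; have cy : cube (iter (t + k.+1) F x) by exact: iter_cube.
  have /andP[a0 a1] := (unit_avoid r k).2 _ (Fcube cx).
  have /andP[b0 b1] := (unit_chi false r).2 _ cx.
  split; first by rewrite mulr_ge0//= ler_piMr.
    exact: (unit_chi false r).2.
  exact: (unit_avoid r _).2 _ (Fcube cy).
apply/andP; split.
  apply: mu_le; [exact: unit_gap_escape|exact: unit_gap_escape|] => x cx.
  have [/andP[A0 A1] /andP[B0 B1] /andP[D0 D1]] := pw x cx.
  rewrite nE avoidS chi_trueE addSn iterS ler_wpM2l//.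
  by rewrite ler_piMl// lerBlDr lerDl.
apply: mu_leD; [exact: unit_gap_escape|exact: unit_gap_escape| |] => [|x cx].
  by apply: unit_funM; [exact: unit_chi|exact: unit_iter (unit_chi _ _)].
have [/andP[A0 A1] /andP[B0 B1] /andP[D0 D1]] := pw x cx.
rewrite nE avoidS chi_trueE addSn iterS.
move: (chi false r x * avoid r k (F x)) A0 A1 => A A0 A1.
move: (chi false r x) A1 => a A1.
move: (chi false r (iter _ F x)) B0 B1 => B B0 B1.
move: (avoid _ _ _) D0 D1 => D D0 D1.
rewrite -lerBlDl; have -> : A * D - A * ((1 - B) * D) = A * B * D by ring.
apply: (@le_trans _ _ (A * B)); first by rewrite ler_piMr// mulr_ge0.
exact: ler_wpM2r.
Qed.

Lemma gap_escape_le r n k t : (N0 <= k)%N -> (k + t <= n)%N ->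
  escape r n <= gap_escape r n k t <= escape r n
    + hit r * (t%:R * hit r + K * Nh * C / c0 / (1 - rho) * rho ^+ k).
Proof.
move=> Nk ktn; have kn : (k <= n)%N := leq_trans (leq_addr _ _) ktn.
have /andP[rho0 rho1] := rho01.
have hit0 : 0 <= hit r := mu_ge0 (unit_chi false r).
set B := K * Nh * C / c0.
have B0 : 0 <= B by rewrite /B !mulr_ge0 ?invr_ge0 ?ltW.
(* The induction on [t] carries the partial geometric sum, which is replaced by [(1 - rho)^-1] only
   at the end. *)
suff /andP[-> H] : escape r n <= gap_escape r n k t <= escape r n
    + hit r * (t%:R * hit r + B * rho ^+ k * \sum_(i < t) rho ^+ i).
  apply: le_trans H _; rewrite lerD2l ler_wpM2l// lerD2l.
  have -> : B / (1 - rho) * rho ^+ k = B * rho ^+ k * (1 - rho)^-1 by ring.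
  rewrite ler_wpM2l ?(mulr_ge0 B0) ?exprn_ge0 ?(ltW rho0)//.
  by apply: sum_powers_le; rewrite rho1 ltW.
elim: t ktn => [|t ih] ktn.
  by rewrite gap_escape0// big_ord0 mul0r mulr0 addr0 mulr0 addr0 lexx.
have ktn' : (k + t < n)%N by rewrite -addnS.
have /andP[ih1 ih2] := ih (ltnW ktn').
have /andP[g1 g2] := gap_escapeS r ktn'.
rewrite (le_trans ih1 g1)/=; apply: le_trans g2 _.
have Nkt : (N0 <= t + k.+1)%N.
  by rewrite (leq_trans Nk)// addnS -addSn leq_addl.
apply: le_trans (lerD ih2 (correlation_le r Nkt)) _.
rewrite -/B -natr1 big_ord_recr/= -addrA lerD2l -mulrDr ler_wpM2l//.
have : B * rho ^+ (t + k.+1) <= B * (rho ^+ k * rho ^+ t).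
  rewrite ler_wpM2l// -exprD addnC addSn exprS ler_piMl ?exprn_ge0//; exact: ltW.
rewrite mulrDl mul1r mulrDr -[B * rho ^+ k * rho ^+ t]mulrA.
move: (B * (rho ^+ k * _)) (B * rho ^+ (t + _)) (B * rho ^+ k * _) (t%:R * _).
by move=> z1 z2 z3 z4; lra.
Qed.

(* The image under [P^(k+1)] of [h] restricted to the points of the target
   whose orbit avoids it at times [1..k]; unlike that restriction itself, it is
   visibly in V_alpha, with a norm bounded uniformly in [r]. *)
Fixpoint escape_density r k : Rq R q -> R :=
  if k is k'.+1 then P (fun x => chi true r x * escape_density r k' x)
  else P (fun x => chi false r x * h x).

Lemma escape_density_bound r k : inV (escape_density r k) /\
  (norm_alpha (escape_density r k) <= (Nh * (M * K) ^+ k.+1)%:E)%E.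
Proof.
have MK0 n : 0 < (M * K) ^+ n by rewrite exprn_gt0// mulr_gt0.
elim: k => [|k [ihV ihN]].
  have [bV bN] := chiK false r Nh_gt0 hV hNh.
  have := PM (mulr_gt0 K_gt0 Nh_gt0) bV bN.
  by rewrite (_ : M * (K * Nh) = Nh * (M * K) ^+ 1)//; ring.
have NMK := mulr_gt0 Nh_gt0 (MK0 k.+1).
have [bV bN] := chiK true r NMK ihV ihN.
have := PM (mulr_gt0 K_gt0 NMK) bV bN.
by rewrite (_ : M * (K * (Nh * (M * K) ^+ k.+1)) = Nh * (M * K) ^+ k.+2)// [in RHS]exprS; ring.
Qed.

(** Duality replaces each [P] by a composition of the test function with [F]. The factor
    [chi true r] joins the test function and, after [k.+1] steps of the orbit, becomes the last
    factor of [avoid r k.+1 (F x)]. *)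
Lemma escape_density_weak r k g : unit_fun g ->
  I (fun x => escape_density r k x * g x) =
  mu (fun x => chi false r x * avoid r k (F x) * g (iter k.+1 F x)).
Proof.
elim: k g => [|k ih] g ug /=.
  have [bV _] := chiK false r Nh_gt0 hV hNh.
  rewrite (transferE P_transfer (inV_L1 bV) ug).
  by apply: eq_integral_cube => x _; rewrite avoid0; ring.
have [GV GN] := escape_density_bound r k.
have NMK : 0 < Nh * (M * K) ^+ k.+1 by rewrite mulr_gt0// exprn_gt0// mulr_gt0.
have [bV _] := chiK true r NMK GV GN.
rewrite (transferE P_transfer (inV_L1 bV) ug).
have ucg : unit_fun (fun x => chi true r x * g (F x)).
  by apply: unit_funM; [exact: unit_chi|exact: (unit_fun_comp mF Fcube ug)].
transitivity (I (fun x => escape_density r k x * (chi true r x * g (F x)))).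
  by apply: eq_integral_cube => x _; ring.
rewrite ih//; apply: mu_eq => x _; rewrite avoid_recr -iterSr /=; ring.
Qed.

Lemma unit_cst1 : unit_fun (fun _ : Rq R q => 1 : R).
Proof. by split => [|x _]; [exact: measurable_cst|rewrite ler01 lexx]. Qed.

(** The 2 counts the linear costs of opening the gap and of adjusting the survival time; the other
    summand is the constant of the geometric tail in [gap_escape_le]. *)
Definition mixing_cst := 2 + K * Nh * C / c0 / (1 - rho).

(** Three comparisons: [escape r n] with its gapped version; the latter, by decay over time [t],
    with [escape r k * survival r (n - (k + t))]; and this survival with [survival r n], from which
    it differs by at most [(k + t)%:R * hit r], a difference weighted by [escape r k <= hit r]. *)
Lemma escape_mixing r n k t : (N0 <= k)%N -> (N0 <= t)%N -> (k + t <= n)%N ->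
  `|escape r n - escape r k * survival r n| <=
  hit r * (mixing_cst * ((k + t)%:R * hit r) + mixing_cst * rho ^+ k)
    + Nh * (M * K) ^+ k.+1 * C * rho ^+ t.
Proof.
move=> Nk Nt ktn; set C' := mixing_cst.
have /andP[rho0 rho1] := rho01.
have hit0 : 0 <= hit r := mu_ge0 (unit_chi false r).
have /andP[g1 g2] := gap_escape_le r Nk ktn.
have [GV GN] := escape_density_bound r k.
have NMK : 0 < Nh * (M * K) ^+ k.+1 by rewrite mulr_gt0// exprn_gt0// mulr_gt0.
have ua := unit_avoid r (n - (k + t)).
have := decay NMK GV GN ua Nt.
rewrite (escape_density_weak r k (unit_iter t ua)).
have -> : I (escape_density r k) = escape r k.
  transitivity (I (fun x => escape_density r k x * 1)).
    by apply: eq_integral_cube => x _; rewrite mulr1.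
  rewrite (escape_density_weak r k unit_cst1); apply: mu_eq => x _.
  by rewrite mulr1.
rewrite -[I (fun x => h x * _)]/(survival r (n - (k + t))).
rewrite (_ : mu _ = gap_escape r n k t); last first.
  by apply: mu_eq => x _; rewrite -iterD.
have Ia : I (avoid r (n - (k + t))) <= 1.
  have I1 : I (fun=> 1) = 1.
    rewrite /integral_cube Rintegral_cst; last exact: measurable_cube.
    by rewrite mul1r; exact: (congr1 fine (lebn_cube q)).
  rewrite -[leRHS]I1; apply: ae_le_integral_cube; [exact: inL1_unit ua|exact: inL1_unit unit_cst1|].
  by apply: aeW => x cx; have /andP[] := ua.2 x cx.
set X := gap_escape r n k t in g1 g2 *.
set G := Nh * (M * K) ^+ k.+1 in NMK *.
have G0 : 0 <= G * C * rho ^+ t.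
  by apply: mulr_ge0; [apply: mulr_ge0; exact: ltW|rewrite exprn_ge0// ltW].
move=> /le_trans/(_ (ler_wpM2l G0 Ia)); rewrite mulr1.
have /andP[w1 w2] := survival_decr r (n - (k + t)) (k + t).
rewrite subnK// in w1 w2.
have /andP[e0 e1] := escape_bounds r k.
set w' := survival r (n - (k + t)) in w1 w2 *; set w := survival r n in w1 w2 *.
set e := escape r k in e0 e1 *; set en := escape r n in g1 g2 *.
set D := hit r in hit0 w2 e1 g2 *.
have eww : 0 <= e * (w' - w) <= D * ((k + t)%:R * D).
  by rewrite mulr_ge0//= ler_pM.
have tk : t%:R * D <= (k + t)%:R * D by rewrite ler_wpM2r// ler_nat leq_addl.
have C'E : D * (C' * ((k + t)%:R * D) + C' * rho ^+ k) =
    D * (2 * ((k + t)%:R * D) + K * Nh * C / c0 / (1 - rho) * rho ^+ k) +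
    D * (K * Nh * C / c0 / (1 - rho) * ((k + t)%:R * D) + 2 * rho ^+ k).
  by rewrite /C' /mixing_cst; ring.
have C'0 : 0 <= D * (K * Nh * C / c0 / (1 - rho) * ((k + t)%:R * D) + 2 * rho ^+ k).
  have B0 : 0 <= K * Nh * C / c0 / (1 - rho).
    by rewrite !mulr_ge0 ?invr_ge0 ?subr_ge0 ?ltW.
  by rewrite mulr_ge0// addr_ge0// mulr_ge0// ?mulr_ge0// exprn_ge0// ltW.
have g3 : X <= en + D * ((k + t)%:R * D + K * Nh * C / c0 / (1 - rho) * rho ^+ k).
  by apply: le_trans g2 _; rewrite lerD2l ler_wpM2l// lerD2r.
rewrite C'E; move: eww; rewrite mulrBr => /andP[ew1 ew2].
move: C'0 g3; rewrite !mulrDr.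
move: (D * (K * Nh * C / c0 / (1 - rho) * rho ^+ k)) => z1.
have -> : D * (2 * ((k + t)%:R * D)) = 2 * (D * ((k + t)%:R * D)) by ring.
move: (D * ((k + t)%:R * D)) ew2 => z2 ew2.
move: (D * (K * Nh * C / c0 / (1 - rho) * z2)) => z3.
move=> C'0 g3; rewrite !ler_norml => /andP[H1 H2]; apply/andP; split; lra.
Qed.

End return_times.

(** * The extremal process *)

Section events.
Context {R : realType} (q : nat) (F : Rq R q -> Rq R q) (h : Rq R q -> R).
Local Notation cube := (@cube R q).
Hypothesis Fcube : forall x, cube x -> cube (F x).

Lemma density_measureE (A : set (Rq R q)) (g : Rq R q -> R) :
  (forall x, cube x -> A x /\ g x = 1 \/ ~ A x /\ g x = 0) ->
  density_measure h (cube `&` A) = mu h g.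
Proof.
move=> Ag; rewrite /density_measure Rintegral_mkcondr.
apply: eq_integral_cube => x /Ag[[Ax ->]|[Ax ->]]; rewrite patchE.
  by rewrite mem_set// mulr1.
by rewrite memNset// mulr0.
Qed.

Lemma chi_false_cases r (x : Rq R q) :
  psi x < r /\ chi false r x = 1 \/ ~ psi x < r /\ chi false r x = 0.
Proof. by rewrite /chi /=; case: (psi x < r); [left|right]. Qed.

Lemma avoid_cases r n x :
  (forall j, (j < n)%N -> ~ psi (iter j F x) < r) /\ avoid F r n x = 1 \/
  ~ (forall j, (j < n)%N -> ~ psi (iter j F x) < r) /\ avoid F r n x = 0.
Proof.
elim: n => [|n ih]; first by left; split => //; rewrite avoid0.
rewrite avoid_recr chi_trueE.
case: (chi_false_cases r (iter n F x)) => -[H ->].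
  by right; split; [move=> /(_ n (ltnSn n))|rewrite subrr mulr0].
rewrite subr0 mulr1; case: ih => -[Hn ->]; [left|right]; split => //.
  by move=> j; rewrite ltnS leq_eqVlt => /predU1P[->//|]; exact: Hn.
by move=> Hj; apply: Hn => j jn; apply: Hj; exact: ltnW.
Qed.

Lemma density_Delta (u : R) : density_measure h (Delta u) = hit h (expR (- u)).
Proof.
apply: density_measureE => x _; rewrite /mkset phi_gtE; exact: chi_false_cases.
Qed.

Lemma density_survival (u : R) n :
  density_measure h (cube `&` [set x | (Mproc F n x <= u%:E)%E]) =
  survival F h (expR (- u)) n.
Proof.
apply: density_measureE => x _.
have -> : [set x | (Mproc F n x <= u%:E)%E] x =
    (forall j, (j < n)%N -> ~ psi (iter j F x) < expR (- u)).
  rewrite /mkset /Mproc; apply/propext; split.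
    move=> /bigmax_leP[_ H] j jn; have := H (Ordinal jn) isT.
    by rewrite /Yproc leNgt phi_gtE => /negP.
  move=> H; apply/bigmax_leP; split => [|i _]; first exact: leNye.
  by rewrite /Yproc leNgt phi_gtE; apply/negP; exact: H.
exact: avoid_cases.
Qed.

Lemma density_first_return (u : R) k :
  density_measure h (first_return F u k) =
  mu h (fun x => chi false (expR (- u)) x * avoid F (expR (- u)) k (F x)
     * chi false (expR (- u)) (iter k.+1 F x)).
Proof.
have DE y : cube y -> Delta u y = (psi y < expR (- u) : Prop).
  move=> cy; rewrite /Delta/=; apply/propext; rewrite phi_gtE; split; first by case.
  by move=> ?; split.
have -> : first_return F u k = cube `&` first_return F u k.
  by apply/esym/setIidr => x [[[cx _] _] _].
apply: density_measureE => x cx.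
have cn n : cube (iter n F x) by exact: iter_cube.
have -> : first_return F u k x = (psi x < expR (- u) /\
   (forall j, (j < k)%N -> ~ psi (iter j F (F x)) < expR (- u)) /\
   psi (iter k.+1 F x) < expR (- u)).
  rewrite /first_return; apply/propext; split.
    move=> [[D0 Dj] Dk]; split; first by rewrite -DE.
    split; last by rewrite -DE.
    move=> j jk; rewrite -iterSr -DE//; have [] := Dj j.+1.
      by rewrite /= jk.
    by [].
  move=> [D0 [Dj Dk]]; split; last by rewrite /preimage/= DE//; exact: (cn k.+1).
  split; first by rewrite DE.
  move=> [//|j] /= jk; split; first exact: cx.
  by rewrite /setC/= DE; [rewrite -/(iter j.+1 F x) iterSr; exact: Dj|exact: (cn j.+1)].
case: (chi_false_cases (expR (- u)) x) => -[H0 ->]; last first.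
  by right; split; [case|rewrite !mul0r].
case: (avoid_cases (expR (- u)) k (F x)) => -[H1 ->]; last first.
  by right; split; [move=> [_ []]|rewrite mulr0 mul0r].
case: (chi_false_cases (expR (- u)) (iter k.+1 F x)) => -[H2 ->]; last first.
  by right; split; [move=> [_ [_]]|rewrite mulr0].
by left; rewrite !mulr1.
Qed.

(** A first return at time [k.+1] means no return up to [k], but one up to [k.+1]. *)
Lemma return_eq (eps0 alpha r : R) k : inV eps0 alpha h ->
  measurable_fun cube F ->
  mu h (fun x => chi false r x * avoid F r k (F x) * chi false r (iter k.+1 F x)) =
  escape F h r k - escape F h r k.+1.
Proof.
move=> hV mF; rewrite /escape /mu -integral_cubeB.
- apply: eq_integral_cube => x _.
  by rewrite avoid_recr -iterSr chi_trueE; ring.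
- by apply: (mu_inL1 hV); exact: unit_escape.
- by apply: (mu_inL1 hV); exact: unit_escape.
Qed.

End events.

Lemma prodmap_cube {R : realType} (q : nat) (T : 'I_q -> R -> R) :
  (forall i t, t \in `[0, 1] -> T i t \in `[0, 1]) ->
  forall x, cube x -> cube (prodmap T x).
Proof. by move=> hT x cx i; rewrite tnth_mktuple; exact: hT. Qed.

Unset Implicit Arguments.

Theorem theorem4p1 (R : realType) (q : nat) (hq : (2 <= q)%N)
  (T : 'I_q -> R -> R)
  (hT : forall i t, t \in `[0, 1] -> T i t \in `[0, 1])
  (T_smooth : piecewise_smooth (prodmap T))
  (T_nonsing : nonsingular (prodmap T))
  (P : (Rq R q -> R) -> Rq R q -> R)
  (P_transfer : transfer_operator (prodmap T) P)
  (eps0 alpha : R) (heps0 : 0 < eps0) (halpha : 0 < alpha <= 1)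
  (PV : forall f, inV eps0 alpha f -> inV eps0 alpha (P f))
  (LY : exists eta D : R, [/\ 0 < eta < 1, 0 < D &
     forall f, inV eps0 alpha f ->
       (norm_alpha eps0 alpha (P f)
        <= eta%:E * norm_alpha eps0 alpha f + D%:E * normL1 f)%E])
  (h : Rq R q -> R) (Q : (Rq R q -> R) -> Rq R q -> R)
  (hV : inV eps0 alpha h)
  (h1 : integral_cube h = 1)
  (QV : forall f, inV eps0 alpha f -> inV eps0 alpha (Q f))
  (PQ : forall f, inV eps0 alpha f ->
     ae_eq_cube (P f) (fun x => integral_cube f * h x + Q f x))
  (Q0 : forall f, inV eps0 alpha f -> integral_cube (Q f) = 0)
  (Qh : ae_eq_cube (Q h) (fun=> 0))
  (Qr : (spectral_radius eps0 alpha Q < 1)%E)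
  (h_pos : exists2 c : R, 0 < c & {ae Leb, forall x, cube x -> c <= h x})
  (s : R) (hs : 0 < s) (u : nat -> R)
  (hu : n%:R * density_measure h (Delta (u n)) @[n --> \oo] --> s)
  (p : nat -> R)
  (hp : forall k,
     density_measure h (first_return (prodmap T) (u n) k)
     / density_measure h (Delta (u n)) @[n --> \oo] --> p k) :
  cvgn (series p) /\
  (let theta := 1 - limn (series p) in
   density_measure h (@cube R q `&` [set x | (Mproc (prodmap T) n x <= (u n)%:E)%E])
     @[n --> \oo] --> expR (- (theta * s))).
Proof.
set F := prodmap T.
have mF : measurable_fun (@cube R q) F by case: T_nonsing.
have Fcube : forall x, cube x -> cube (F x) := prodmap_cube hT.
have h_inv := density_invariant P_transfer hV h1 PQ Qh.
have [C [rho [N0 [C0 rho01 decay]]]] :=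
  decay_of_correlations heps0 mF Fcube P_transfer hV h1 QV PQ Q0 Qh Qr.
have [c0 c0_gt0 h_ge] := h_pos.
have [K K0 chiK] := chi_mul_bounded heps0 halpha hq.
have [eta [D [/andP[eta0 _] D0 LYP]]] := LY.
(* As [normL1] is at most [norm_alpha], (LY) bounds [P] on V_alpha by [eta + D]. *)
have M0 : 0 < eta + D by exact: addr_gt0.
have PM f N : 0 < N -> inV eps0 alpha f -> (norm_alpha eps0 alpha f <= N%:E)%E ->
    inV eps0 alpha (P f) /\ (norm_alpha eps0 alpha (P f) <= ((eta + D) * N)%:E)%E.
  move=> N_gt0 fV fN; split; first exact: PV.
  apply: le_trans (LYP f fV) _; rewrite mulrDl EFinD !EFinM.
  apply: leeD; rewrite lee_pmul2l ?lte_fin//.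
  by apply: le_trans fN; exact: normL1_le_alpha.
have [Nh Nh0 hNh] : exists2 Nh : R, 0 < Nh & (norm_alpha eps0 alpha h <= Nh%:E)%E.
  have hfin : norm_alpha eps0 alpha h \is a fin_num.
    rewrite ge0_fin_numE ?norm_alpha_ge0//; case: hV => hL1 hsemi.
    by rewrite lte_add_pinfty//; move/integrableP : hL1 => [].
  exists (fine (norm_alpha eps0 alpha h) + 1).
    by rewrite ltr_wpDl// fine_ge0// norm_alpha_ge0.
  by rewrite EFinD fineK// leeDl.
pose r n := expR (- u n).
pose d n := hit h (r n).
pose w n m := survival F h (r n) m.
pose a n m := escape F h (r n) m.
have ds : n%:R * d n @[n --> \oo] --> s.
  by apply: cvg_trans hu; apply: near_eq_cvg; near=> n; rewrite density_Delta.
have ab n m : 0 <= a n m <= d n := escape_bounds mF Fcube hV c0_gt0 h_ge (r n) m.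
have d0 n : 0 <= d n by have /andP[x0 x1] := ab n 0%N; exact: le_trans x1.
have d_gt0 : \forall n \near \oo, 0 < d n.
  near=> n; rewrite lt_neqAle d0 andbT eq_sym; apply/eqP => dn0.
  have : 0 < n%:R * d n by near: n; exact: (cvgr_gt s).
  by rewrite dn0 mulr0 ltxx.
have hp' k : (a n k - a n k.+1) / d n @[n --> \oo] --> p k.
  apply: cvg_trans (hp k); apply: near_eq_cvg; near=> n.
  by rewrite density_Delta density_first_return// (return_eq Fcube _ _ hV mF).
pose th k := 1 - series p k.
(* Telescoping: [a n 0 = d n], and each decrement [a n k - a n k.+1], relative to [d n], tends to
   [p k]. *)
have ath k : a n k / d n @[n --> \oo] --> th k.
  elim: k => [|k ih].
    rewrite /th /series/= big_geq// subr0.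
    have c1 : (1 : R) @[n --> \oo] --> (1 : R) by exact: cvg_cst.
    apply: cvg_trans c1; apply: near_eq_cvg; near=> n.
    have dn : 0 < d n by near: n.
    rewrite (_ : a n 0%N = d n) ?divff ?gt_eqF//.
    by apply: mu_eq => x _; rewrite avoid0 mulr1.
  have -> : th k.+1 = th k - p k by rewrite /th seriesSr opprD addrA.
  have c : a n k / d n - (a n k - a n k.+1) / d n @[n --> \oo] --> th k - p k.
    by apply: cvgB.
  apply: cvg_trans c; apply: near_eq_cvg; near=> n.
  by ring.
have adiv n k : 0 <= a n k / d n <= 1.
  have /andP[a0 a1] := ab n k; rewrite divr_ge0//=.
  have [dn0|dn] := eqVneq (d n) 0; first by rewrite dn0 invr0 mulr0.
  by rewrite ler_pdivrMr ?mul1r// lt_neqAle eq_sym dn d0.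
have th0 k : 0 <= th k.
  rewrite -(cvg_lim _ (ath k))//; apply: limr_ge; first by apply/cvg_ex; exists (th k).
  by near=> n; case/andP: (adiv n k).
have p0 k : 0 <= p k.
  rewrite -(cvg_lim _ (hp' k))//; apply: limr_ge; first by apply/cvg_ex; exists (p k).
  near=> n; rewrite divr_ge0// -(return_eq Fcube _ _ hV mF).
  apply: (mu_ge0 hV c0_gt0 h_ge); apply: unit_funM; first exact: unit_escape.
  by apply: unit_iter => //; exact: unit_chi.
(* The terms are nonnegative, and the partial sums stay below 1 because [th k], a limit of quotients
   in [[0, 1]], is nonnegative. *)
have cp : cvgn (series p).
  apply: nondecreasing_is_cvgn.
    by apply/nondecreasing_seqP => n; rewrite seriesSr lerDl.
  by exists 1 => _ [k _ <-]; rewrite -subr_ge0; exact: th0.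
split; first exact: cp.
move=> theta.
have thl : th k @[k --> \oo] --> theta by apply: cvgB cp; exact: cvg_cst.
have wexp : w n n @[n --> \oo] --> expR (- (theta * s)).
  apply: (@recursion_cvg_expR R s (mixing_cst C rho c0 K Nh) rho theta N0
    (fun k => Nh * ((eta + D) * K) ^+ k.+1 * C) th d w a).
  - have /andP[rho0 rho1] := rho01.
    by rewrite addr_ge0// !mulr_ge0 ?invr_ge0 ?subr_ge0 ?ltW.
  - by have /andP[rho0 ->] := rho01; rewrite ltW.
  - by move=> n; exact: survival0.
  - by move=> n m; exact: (survivalS mF Fcube hV h_inv).
  - by move=> n m; exact: (survival_ge0 mF Fcube hV c0_gt0 h_ge).
  - exact: ab.
  - move=> n m k t Nk Nt ktm.
    exact: (escape_mixing mF Fcube P_transfer hV h_inv C0 rho01 decay c0_gt0 h_ge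
      K0 M0 Nh0 chiK PM hNh).
  - exact: ds.
  - move=> k; have c : n%:R * d n * (a n k / d n) @[n --> \oo] --> s * th k.
      exact: cvgM.
    apply: cvg_trans c; apply: near_eq_cvg.
    near=> n; have dn : 0 < d n by near: n.
    by field; rewrite gt_eqF.
  - exact: thl.
apply: cvg_trans wexp; apply: near_eq_cvg; near=> n.
by rewrite density_survival.
Unshelve. all: end_near.
Qed.
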